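(* For all $\lambda>0$ and all $j,k\in S$ with $j\neq k$, $$\gamma_{j,k}(\lambda)=\frac{\lambda\,\widehat\gamma_{j,k}(\lambda+\xi)+\xi\,\widehat\gamma_{r,k}(\lambda+\xi)}{\lambda+\xi\,\widehat\gamma_{r,k}(\lambda+\xi)}.$$
   Context: Let $r$ be a nonnegative integer, $S=\{r,r+1,r+2,\ldots\}$, and let $\alpha_n>0$ ($n\ge r$), $\beta_n\ge 0$ ($n\ge r+1$), $\xi>0$ be constants. $\{N(t);t\ge 0\}$ is the continuous-time Markov chain on $S$ (birth-death process with catastrophes) with transitions: $n\to n+1$ with rate $\alpha_n$ for $n\ge r$; $n\to n-1$ with rate $\beta_n$ for $n\ge r+2$; $r+1\to r$ with rate $\beta_{r+1}+\xi$; $n\to r$ with rate $\xi$ for $n\ge r+2$. $\{\widehat N(t);t\ge 0\}$ is the birth-death process on $S$ with the same birth rates $\alpha_n$ and death rates $\beta_n$ but without catastrophes (i.e. its only transitions are $n\to n+1$ with rate $\alpha_n$ for $n\ge r$ and $n\to n-1$ with rate $\beta_n$ for $n\ge r+1$), assumed non-explosive: $\sum_{n\ge r}\Pr\{\widehat N(t)=n\mid \widehat N(0)=j\}=1$ for all $j\in S$, $t\ge0$. For $j,k\in S$, $j\ne k$, $T_{j,k}=\inf\{t\ge 0: N(t)=k\}$ given $N(0)=j$, with (possibly defective) density $g_{j,k}(t)=\frac{d}{dt}\Pr\{T_{j,k}\le t\}$ and Laplace transform $\gamma_{j,k}(\lambda)=\int_0^\infty e^{-\lambda t}g_{j,k}(t)\,dt$.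 Likewise $\widehat T_{j,k}$, $\widehat g_{j,k}$, $\widehat\gamma_{j,k}$ denote the first-visit time, its (possibly defective) density and the Laplace transform of that density for $\widehat N(t)$. Convention: $\widehat\gamma_{k,k}(\lambda)=1$ for all $k\in S$ and $\lambda>0$. *)

(* Defs.v *)
(* MathComp-Analysis *)
From HB Require Import structures.
From mathcomp Require Import all_boot all_order all_algebra.
From mathcomp Require Import all_classical all_reals all_analysis.
Set Implicit Arguments.
Unset Strict Implicit.
Unset Printing Implicit Defensive.
Import Order.TTheory GRing.Theory Num.Theory.
Import numFieldNormedType.Exports.
Local Open Scope classical_set_scope.
Local Open Scope ring_scope.

(* The state space S = {r, r+1, ...} is a subset of nat: the rates below vanish
   out of states n < r, and only initial states j >= r are considered. *)

Definition bd_rate (R : realType) (r : nat) (alpha beta : nat -> R)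
    (n m : nat) : R :=
  if (r <= n)%N && (m == n.+1) then alpha n
  else if (r.+1 <= n)%N && (n == m.+1) then beta n
  else 0.

Definition bdc_rate (R : realType) (r : nat) (alpha beta : nat -> R) (xi : R)
    (n m : nat) : R :=
  if (r <= n)%N && (m == n.+1) then alpha n
  else if (r.+2 <= n)%N && (n == m.+1) then beta n
  else if (n == r.+1) && (m == r) then beta r.+1 + xi
  else if (r.+2 <= n)%N && (m == r) then xi
  else 0.

Definition exit_rate (R : realType) (q : nat -> nat -> R) (n : nat) : R :=
  fine (\sum_(0 <= m <oo | m != n) (q n m)%:E)%E.

Definition jump_prob (R : realType) (q : nat -> nat -> R) (n m : nat) : R :=
  if m == n then 0 else q n m / exit_rate q n.

(* Right-continuous minimal Markov chain with transition rates q started at j,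
   in the jump chain / holding time sense: the jump chain Y is a discrete-time
   Markov chain with transition matrix [jump_prob q], and given Y 0, ..., Y n
   the holding times H 0, ..., H n are independent, H m being exponential of
   rate [exit_rate q (Y m)].  [X t w = None] means that the chain has exploded
   by time t.  Since holding times are finite, this only covers chains that
   visit no absorbing state; all exit rates on S are positive here. *)
Definition ctmc_from (R : realType) (d : measure_display)
    (Omega : measurableType d) (P : probability Omega R)
    (q : nat -> nat -> R) (j : nat) (X : R -> Omega -> option nat) : Prop :=
  exists (Y : nat -> {RV P >-> nat}) (H : nat -> {RV P >-> R}),
  [/\ forall (n : nat) (i : nat -> nat),
        P [set w | forall m, (m <= n)%N -> Y m w = i m] =
        ((i 0%N == j)%:R * \prod_(m < n) jump_prob q (i m) (i m.+1))%:E,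
      forall (n : nat) (i : nat -> nat) (B : nat -> set R),
        (forall m, measurable (B m)) ->
        P [set w | forall m, (m <= n)%N -> Y m w = i m /\ B m (H m w)] =
        (P [set w | forall m, (m <= n)%N -> Y m w = i m] *
         \prod_(m < n.+1) exponential_prob (exit_rate q (i m)) (B m))%E,
      forall n w, 0 < H n w
    & forall (t : R) (w : Omega) (x : nat), 0 <= t ->
        X t w = Some x <->
        exists n, [/\ \sum_(m < n) H m w <= t,
                      t < \sum_(m < n.+1) H m w & Y n w = x]].

Definition non_explosive (R : realType) (d : measure_display)
    (Omega : measurableType d) (P : nat -> probability Omega R) (r : nat)
    (X : R -> Omega -> option nat) : Prop :=
  forall (j : nat) (t : R), (r <= j)%N -> 0 <= t ->
    (\sum_(r <= n <oo) P j [set w | X t w = Some n])%E = 1%E.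

Definition first_visit (R : realType) (Omega : Type)
    (X : R -> Omega -> option nat) (k : nat) (w : Omega) : \bar R :=
  ereal_inf [set t%:E | t in [set t : R | 0 <= t /\ X t w = Some k]].

(* The two-sided derivative may fail to exist at t = 0, where [derive1] is then
   a default value; this does not affect the integral below. *)
Definition first_visit_density (R : realType) (d : measure_display)
    (Omega : measurableType d) (P : nat -> probability Omega R)
    (X : R -> Omega -> option nat) (j k : nat) : R -> R :=
  derive1 (fun t : R => fine (P j [set w | (first_visit X k w <= t%:E)%E])).

Definition first_visit_laplace (R : realType) (d : measure_display)
    (Omega : measurableType d) (P : nat -> probability Omega R)
    (X : R -> Omega -> option nat) (j k : nat) (lambda : R) : R :=
  if j == k then 1
  else \int[lebesgue_measure]_(t in `[0, +oo[)
         (expR (- lambda * t) * first_visit_density P X j k t).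

(* Main.v *)
Require Import Defs.
From HB Require Import structures.
From mathcomp Require Import all_boot all_order all_algebra.
From mathcomp Require Import all_classical all_reals all_analysis.
From mathcomp Require Import measurable_realfun ring lra zify.
Set Implicit Arguments.
Unset Strict Implicit.
Unset Printing Implicit Defensive.
Import Order.TTheory GRing.Theory Num.Theory.
Import numFieldNormedType.Exports.
Local Open Scope classical_set_scope.
Local Open Scope ring_scope.

(* Conditioning on the first jump shows that F_n(t) = Pr(T_{n,k} <= t), n <> k,
   satisfies F_n(t) = int_0^t a e^{-a(t-u)} sum_m p(n,m) F_m(u) du, where a is
   the exit rate of n.  Hence F_n is C^1 on ]0, +oo[ and the transforms solve
   the linear system (l + a) gamma_n = sum_m q(n,m) gamma_m for n <> k, with
   gamma_k = 1.  If G is the solution for the chain with catastrophes at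
   lambda, then G - xi / (lambda + xi) G_r solves, away from k, the system of
   the chain without catastrophes at lambda + xi.  A bounded solution of the
   latter vanishing at k is bounded by a multiple of E_n[e^{-(lambda + xi) S_i}],
   S_i being the i-th jump time, for every i; this tends to 0 by
   non-explosion.  So G is an affine function of the transforms without
   catastrophes, whose coefficients are read off at n = k and n = r. *)

(** * The space of paths of states and holding times *)

Section path_space.
Context {R : realType}.

(** Each chain is given only through the joint law of its jump chain and holding times on an
    arbitrary probability space, which carries no shift. Both processes are therefore transported to
    a common path space, where dropping the first entry is a map and the Markov property at the
    first jump is an equality of two measures, checked on cylinders. The unknowns are transforms of
    distribution functions, not of densities: Tonelli alone then gives the linear system, also for
    defective first-visit times. Densities are recovered separately, from F' = a (h - F), where h is
    the mean of the F_m over the first jump. As for the constant xi / (lambda + xi) G_r: raising the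
    parameter by xi replaces the rate of leaving n by a catastrophe, and there remains a source term
    xi G_r which is the same in every state; at r, where no catastrophe occurs, it only balances the
    raised parameter. A constant source is absorbed by a constant, because the rates out of n sum to
    its exit rate. *)

Definition cylinder (n : nat) (i : nat -> nat) (B : nat -> set R) :
    set (nat -> nat * R) :=
  [set w | forall m, (m <= n)%N -> (w m).1 = i m /\ B m (w m).2].

(** The empty set is included because two cylinders with conflicting states are disjoint, and the
    family has to be stable under intersection. *)
Definition cylinders : set (set (nat -> nat * R)) :=
  [set A | A = set0 \/ exists n i B,
     (forall m, measurable (B m)) /\ A = cylinder n i B].

(* The n-th entry of a path is the state after n jumps and its holding time. *)
Definition chain_path := g_sigma_algebraType cylinders.

Lemma cylinders_setI_closed : setI_closed cylinders.
Proof.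
suff H n i B n' i' B' : (n <= n')%N -> (forall m, measurable (B m)) ->
    (forall m, measurable (B' m)) ->
    cylinders (cylinder n i B `&` cylinder n' i' B').
  move=> _ _ [->|[n [i [B [mB ->]]]]] [->|[n' [i' [B' [mB' ->]]]]].
  - by rewrite setI0; left.
  - by rewrite set0I; left.
  - by rewrite setI0; left.
  - have [nn'|/ltnW n'n] := leqP n n'; first exact: H.
    by rewrite setIC; exact: H.
move=> nn' mB mB'.
have [ii'|ii'] := pselect (forall m, (m <= n)%N -> i m = i' m); [right|left].
  (* The longer state sequence wins; the shorter cylinder only restricts the holding times up to
     index n. *)
  exists n', i', (fun m => B' m `&` (if (m <= n)%N then B m else setT)).
  split=> [m|]; first by apply: measurableI => //; case: ifP.
  apply/seteqP; split=> [w [w1 w2] m mn'|w w1].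
    split; first by case: (w2 _ mn').
    split; first by case: (w2 _ mn').
    by case: ifPn => // mn; case: (w1 _ mn).
  split=> m mn.
    have [-> [_]] := w1 _ (leq_trans mn nn').
    by rewrite mn ii'.
  by have [-> []] := w1 _ mn.
apply/seteqP; split=> [w [w1 w2]|//]; apply: ii' => m mn.
by rewrite -(w1 m mn).1 (w2 m (leq_trans mn nn')).1.
Qed.

Lemma measurable_cylinder n i B : (forall m, measurable (B m)) ->
  measurable (cylinder n i B : set chain_path).
Proof. by move=> mB; apply: sub_sigma_algebra; right; exists n, i, B. Qed.

Lemma path_measure_unique (m1 m2 : {measure set chain_path -> \bar R}) :
  (m1 setT < +oo)%E ->
  (forall n i B, (forall m, measurable (B m)) ->
     m1 (cylinder n i B) = m2 (cylinder n i B)) ->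
  forall A, measurable A -> m1 A = m2 A.
Proof.
move=> m1oo m12.
(* The whole space is no cylinder, since a cylinder prescribes states; it is covered by the
   countably many cylinders that prescribe the initial state only. *)
apply: (@measure_unique _ R chain_path cylinders
  (fun n => cylinder 0 (cst n) (cst setT))) => //.
- exact: cylinders_setI_closed.
- by move=> i; right; exists 0%N, (cst i), (cst setT); split=> [m|//]; exact: measurableT.
- apply/seteqP; split=> // w _; exists (w 0%N).1 => // m.
  by rewrite leqn0 => /eqP ->.
- by move=> _ [->|[n [i [B [mB ->]]]]]; [rewrite !measure0 | exact: m12].
- move=> k; apply: le_lt_trans m1oo; apply: le_measure => //; rewrite inE //.
  by apply: measurable_cylinder => m; exact: measurableT.
Qed.

(** A cylinder fixes all states up to n, so the earlier ones are summed out; finite sequences index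
    the union because they are countable, unlike functions. *)
Lemma measurable_coord (n : nat) (A : set nat) (B : set R) : measurable B ->
  measurable ([set w : chain_path | A (w n).1 /\ B (w n).2] : set chain_path).
Proof.
move=> mB.
have -> : [set w : chain_path | A (w n).1 /\ B (w n).2] =
   \bigcup_(s in [set s : seq nat | A (nth 0%N s n)])
     (cylinder n (nth 0%N s) (fun m => if m == n then B else setT)).
  apply/seteqP; split=> [w [w1 w2]|w [s /= As] /(_ n (leqnn n))]; last first.
    by rewrite eqxx => -[w1 w2]; rewrite /= w1.
  exists (mkseq (fun m => (w m).1) n.+1) => /=; first by rewrite nth_mkseq.
  move=> m mn; rewrite nth_mkseq//; split=> //.
  by case: eqP => // ->.
rewrite bigcup_mkcond.
apply: countable_bigcupT_measurable => [|s]; first exact: countableP.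
case: ifP => // _.
by apply: measurable_cylinder => m; case: ifP => // _; exact: measurableT.
Qed.

Lemma measurable_state (n k : nat) : measurable ([set w : chain_path | (w n).1 = k]).
Proof.
have := measurable_coord n [set k] measurableT.
by congr measurable; apply/seteqP; split=> w //= [].
Qed.

Definition holding (n : nat) (w : chain_path) : R := (w n).2.

Lemma measurable_holding (n : nat) : measurable_fun setT (holding n).
Proof.
move=> _ B mB; have := measurable_coord n setT mB; rewrite setTI.
by congr measurable; apply/seteqP; split=> w //= [].
Qed.

Lemma measurable_to_path d (T : measurableType d) (Z : T -> chain_path) :
  (forall n a B, measurable B ->
     measurable [set x | (Z x n).1 = a /\ B (Z x n).2]) ->
  measurable_fun setT Z.
Proof.
move=> HZ; apply: (@measurability _ _ T chain_path setT Z cylinders) => //.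
move=> _ [A cA <-]; rewrite setTI.
case: cA => [->|[n [i [B [mB ->]]]]]; first by rewrite preimage_set0.
rewrite (_ : _ @^-1` _ = \bigcap_m (if (m <= n)%N then
    [set x | (Z x m).1 = i m /\ B m (Z x m).2] else setT)).
  by apply: bigcapT_measurable => m; case: ifP => // _; exact: HZ.
apply/seteqP; split=> [x Hx m _|x Hx m mn]; last by have := Hx m I; rewrite mn.
by case: ifPn => // mn; exact: Hx.
Qed.

Definition path_tail (w : chain_path) : chain_path := fun n => w n.+1.

Lemma measurable_path_tail : measurable_fun setT path_tail.
Proof.
by apply: measurable_to_path => n a B mB; exact: (measurable_coord n.+1 [set a]).
Qed.

Definition jump_time (n : nat) (w : chain_path) : R := \sum_(m < n) holding m w.

Lemma jump_timeS n w : jump_time n.+1 w = holding 0 w + jump_time n (path_tail w).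
Proof. by rewrite /jump_time big_ord_recl. Qed.

Lemma measurable_jump_time n : measurable_fun setT (jump_time n).
Proof. by apply: measurable_sum => m; exact: measurable_holding. Qed.

End path_space.
Arguments chain_path : clear implicits.

HB.instance Definition _ (R : realType) :=
  isMeasurableFun.Build _ _ (chain_path R) (chain_path R) path_tail measurable_path_tail.

(** * The Markov property at the first jump *)

Section first_step.
Context {R : realType}.

Lemma product_finite_measure_unique d1 d2 (T1 : measurableType d1)
    (T2 : measurableType d2) (m1 m2 : {measure set (T1 * T2) -> \bar R}) :
  (m1 setT < +oo)%E ->
  (forall A B, measurable A -> measurable B -> m1 (A `*` B) = m2 (A `*` B)) ->
  forall C, measurable C -> m1 C = m2 C.
Proof.
move=> m1oo m12.
apply: (measure_unique [set A `*` B | A in measurable & B in measurable]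
  (cst setT)) => //.
- exact: measurable_prod_measurableType.
- move=> _ _ [A1 mA1 [B1 mB1 <-]] [A2 mA2 [B2 mB2 <-]].
  exists (A1 `&` A2); first exact: measurableI.
  exists (B1 `&` B2); first exact: measurableI.
  by rewrite -setXI.
- by move=> i; exists setT => //; exists setT => //; rewrite setXTT.
- by rewrite bigcup_const.
- by move=> _ [A mA [B mB <-]]; exact: m12.
Qed.

(* The library's instance depends on a proof of [0 < a] and is not inferred. *)
Definition expo (a : R) (a0 : 0 < a) : probability (measurableTypeR R) R :=
  exponential_distribution_exponential_prob__canonical__probability_measure_Probability a0.

(** The two distributional conditions of [ctmc_from] multiplied into one formula, which determines L
    by its values on cylinders. *)
Definition chain_law (q : nat -> nat -> R) (j : nat)
    (L : set (chain_path R) -> \bar R) : Prop :=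
  forall n i B, (forall m, measurable (B m)) ->
    L (cylinder n i B) =
    (((i 0%N == j)%:R * \prod_(m < n) jump_prob q (i m) (i m.+1))%:E *
     \prod_(m < n.+1) exponential_prob (exit_rate q (i m)) (B m))%E.

Variables (q : nat -> nat -> R) (j m : nat).
Hypotheses (qj0 : 0 < exit_rate q j) (pjm0 : 0 <= jump_prob q j m).
Variables Lj Lm : probability (chain_path R) R.
Hypotheses (lawj : chain_law q j Lj) (lawm : chain_law q m Lm).

Let E : set (chain_path R) := [set w | (w 0%N).1 = j /\ (w 1%N).1 = m].

Let mE : measurable E.
Proof. exact: measurableI (measurable_state 0 j) (measurable_state 1 m). Qed.

(** Prepending j and B to a cylinder that starts at m gives a cylinder one step longer, and the
    product formula splits off its first factors. If the cylinder does not start at m, both sides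
    vanish. *)
Let first_rect (B : set R) n i (B' : nat -> set R) : measurable B ->
  (forall m, measurable (B' m)) ->
  Lj [set w | E w /\ B (holding 0 w) /\ cylinder n i B' (path_tail w)] =
  ((jump_prob q j m)%:E * exponential_prob (exit_rate q j) B *
    Lm (cylinder n i B'))%E.
Proof.
move=> mB mB'.
have [i0m|i0m] := eqVneq (i 0%N) m; last first.
  rewrite lawm// (negbTE i0m) mul0r mul0e mule0.
  rewrite (_ : mkset _ = set0) ?measure0//; apply/seteqP; split=> // w.
  move=> [[_ wm] [_]] /(_ _ (leq0n n))[] wi _.
  by move/eqP: i0m; apply; rewrite -wi -wm.
pose i' k := if k is l.+1 then i l else j.
pose B'' k := if k is l.+1 then B' l else B.
rewrite (_ : mkset _ = cylinder n.+1 i' B''); last first.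
  apply/seteqP; split=> [w [[wj wm] [Bw cw]] [|k] /=|w cw]; first by split.
    by rewrite ltnS => /cw.
  have [] := cw 0%N isT; have [] := cw 1%N isT; rewrite /i' /B'' /= => w1 _ w0 Bw.
  by split; [rewrite /E/= w0 w1|split=> // k kn; exact: (cw k.+1)].
rewrite lawj; last by case.
rewrite eqxx mul1r big_ord_recl/= i0m [X in (_ * X)%E = _]big_ord_recl/=.
rewrite lawm// i0m eqxx mul1r EFinM -!muleA; congr (_ * _)%E.
by rewrite muleCA.
Qed.

Let phi (w : chain_path R) : measurableTypeR R * chain_path R :=
  (holding 0 w, path_tail w).
Let mphi : measurable_fun setT phi.
Proof.
apply/measurable_fun_pairP; split; first exact: measurable_holding.
exact: measurable_path_tail.
Qed.


Let first_tail (B : set R) (A : set (chain_path R)) :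
  measurable B -> measurable A ->
  Lj [set w | E w /\ B (holding 0 w) /\ A (path_tail w)] =
  ((jump_prob q j m)%:E * exponential_prob (exit_rate q j) B * Lm A)%E.
Proof.
move=> mB.
(* For fixed B both sides are finite measures in A; c is the scaling factor of the right one, made
   real so that [mscale] applies. *)
pose c := fine ((jump_prob q j m)%:E * expo qj0 B).
have cE : (c%:E = (jump_prob q j m)%:E * exponential_prob (exit_rate q j) B)%E.
  by rewrite fineK// fin_numM// fin_num_measure.
have c0 : 0 <= c by rewrite fine_ge0// mule_ge0.
have mEB : measurable (E `&` holding 0 @^-1` B).
  apply: measurableI => //.
  by rewrite -[X in measurable X]setTI; exact: measurable_holding.
move=> mA; rewrite -cE.
transitivity (pushforward (mrestr Lj mEB) (@path_tail R) A).
  rewrite /pushforward /mrestr; congr (Lj _).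
  by apply/seteqP; split=> w; rewrite /=; tauto.
apply: (@path_measure_unique R (pushforward (mrestr Lj mEB) (@path_tail R))
  (mscale (NngNum c0) Lm)) => //.
- rewrite /pushforward /mrestr; apply: le_lt_trans (ltry 1).
  by apply: probability_le1; rewrite preimage_setT setTI.
- move=> n i B' mB'; transitivity (c%:E * Lm (cylinder n i B'))%E; last by [].
  rewrite cE -first_rect// /pushforward /mrestr; congr (Lj _).
  by apply/seteqP; split=> w; rewrite /=; tauto.
Qed.

(** On the event that the first jump leads from j to m, the holding time and the rest of the path
    are independent, the latter distributed as a chain started at m. [first_tail] gives this for
    rectangles, and finite measures on a product are determined by them. *)
Lemma first_step (C : set (measurableTypeR R * chain_path R)) : measurable C ->
  Lj [set w | [/\ (w 0%N).1 = j, (w 1%N).1 = m & C (holding 0 w, path_tail w)]] =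
  ((jump_prob q j m)%:E * (expo qj0 \x Lm) C)%E.
Proof.
move=> mC.
pose Phi : {mfun chain_path R >-> (measurableTypeR R * chain_path R)%type} :=
  mfun_Sub (mem_set mphi).
have -> : [set w | [/\ (w 0%N).1 = j, (w 1%N).1 = m & C (phi w)]] =
    Phi @^-1` C `&` E.
  by apply/seteqP; split=> w /=; [case|case=> ? []].
apply: (@product_finite_measure_unique _ _ (measurableTypeR R) (chain_path R)
  (pushforward (mrestr Lj mE) Phi) (mscale (NngNum pjm0) (expo qj0 \x Lm)%E)) => //.
- rewrite /pushforward /mrestr; apply: le_lt_trans (ltry 1).
  by apply: probability_le1; rewrite preimage_setT setTI.
- move=> A B mA mB.
  transitivity ((jump_prob q j m)%:E * (expo qj0 \x Lm) (A `*` B))%E; last by [].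
  rewrite product_measure1E// muleA.
  rewrite -first_tail// /pushforward /mrestr; congr (Lj _).
  by apply/seteqP; split=> w; rewrite /=; tauto.
Qed.

End first_step.

(** * Integration against the exponential law and reflection of Lebesgue measure *)

Section convolution.
Context {R : realType}.
Local Notation leb := (@lebesgue_measure R).

Lemma expo_product_integral d (T : measurableType d) (a : R) (a0 : 0 < a)
    (L : probability T R) (C : set (measurableTypeR R * T)) :
  measurable C ->
  ((expo a0 \x L) C =
   \int[leb]_x ((exponential_pdf a x)%:E * L (xsection C x)))%E.
Proof.
move=> mC.
(* The variant [\x^] integrates the exponential variable inside, where its density can be inserted
   before Tonelli exchanges the integrals. *)
rewrite (@product_measure_unique _ _ _ _ _ _ _ (expo a0 \x^ L)%E)//; last first.
  by move=> A B mA mB /=; rewrite product_measure2E.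
pose f (z : measurableTypeR R * T) := ((exponential_pdf a z.1)%:E * (\1_C z)%:E)%E.
have f0 z : (0 <= f z)%E.
  by rewrite mule_ge0// lee_fin// exponential_pdf_ge0// ltW.
have mf : measurable_fun setT f.
  apply: emeasurable_funM; last exact/measurable_EFinP.
  apply/measurable_EFinP; apply: measurableT_comp => //.
  exact: measurable_exponential_pdf.
transitivity (\int[L]_y \int[leb]_x f (x, y))%E.
  apply: eq_integral => y _.
  rewrite /expo/= /exponential_prob [LHS]integral_mkcond.
  apply: eq_integral => x _; rewrite patchE /f/= mem_ysection indicE.
  by case: (_ \in C); rewrite ?mule1 ?mule0.
rewrite -fubini_tonelli//; apply: eq_integral => x _.
transitivity (\int[L]_y ((exponential_pdf a x)%:E * (\1_(xsection C x) y)%:E))%E.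
  by apply: eq_integral => y _; rewrite /f/= !indicE mem_xsection.
have mCx := measurable_xsection x mC.
rewrite ge0_integralZl//=; last 2 first.
- exact/measurable_EFinP.
- by rewrite lee_fin exponential_pdf_ge0// ltW.
by rewrite integral_indic// setIT.
Qed.

(** The map x to t - x pulls ]u, v] back to [t - v, t - u[, of the same length, hence preserves
    Lebesgue measure. It turns the first holding time into the time left after the first jump. *)
Lemma ge0_integral_reflect (f : R -> \bar R) (t : R) :
  measurable_fun setT f -> (forall x, 0 <= f x)%E ->
  (\int[leb]_x f (t - x)%R = \int[leb]_x f x)%E.
Proof.
move=> mf f0.
have mr : measurable_fun setT (fun x : measurableTypeR R => t - x : measurableTypeR R).
  by apply: measurable_funB.
pose r : {mfun measurableTypeR R >-> measurableTypeR R} :=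
  @mfun_Sub _ _ (measurableTypeR R) (measurableTypeR R) _ (mem_set mr).
transitivity (\int[pushforward leb r]_x f x)%E.
  by rewrite ge0_integral_pushforward.
apply: eq_measure_integral => A mA _.
apply/esym/lebesgue_measure_unique => //= _ [[u v]] _ <-.
rewrite /pushforward (_ : r @^-1` _ = `[t - v, t - u[%classic).
  rewrite !lebesgue_measure_itv/= !lte_fin ltrD2l ltrN2.
  by case: ifP => // _; rewrite -!EFinB; congr EFin; ring.
by apply/seteqP; split=> x /=; rewrite !in_itv/=; lra.
Qed.

End convolution.

(** * Renewal equations for first visits and jump times *)

Section renewal.
Context {R : realType}.
Local Notation leb := (@lebesgue_measure R).
Variables (r : nat) (q : nat -> nat -> R).
Hypothesis q_ge0 : forall n m, 0 <= q n m.
Hypothesis qnn : forall n, q n n = 0.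
Hypothesis q_supp : forall n m, (r <= n)%N -> q n m != 0 -> (r <= m <= n.+1)%N.
Hypothesis exit_gt0 : forall n, (r <= n)%N -> 0 < exit_rate q n.
Variable L : nat -> probability (chain_path R) R.
Hypothesis lawL : forall n, (r <= n)%N -> chain_law q n (L n).

Lemma jump_probE n m : jump_prob q n m = q n m / exit_rate q n.
Proof. by rewrite /jump_prob; case: eqP => // ->; rewrite qnn mul0r. Qed.

Lemma jump_prob_ge0 n m : (r <= n)%N -> 0 <= jump_prob q n m.
Proof. by move=> rn; rewrite jump_probE divr_ge0// ltW// exit_gt0. Qed.

Lemma law_expo n (rn : (r <= n)%N) A :
  exponential_prob (exit_rate q n) A = expo (exit_gt0 rn) A.
Proof. by []. Qed.

Lemma law_init n : (r <= n)%N -> L n [set w | (w 0%N).1 = n] = 1%E.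
Proof.
move=> rn; have /(_ 0%N (cst n) (cst setT) (fun=> measurableT)) := lawL rn.
rewrite big_ord0 big_ord1 eqxx mulr1 mul1e (law_expo rn) probability_setT => <-.
congr (L n _); apply/seteqP; split=> w /=.
  by move=> wn m; rewrite leqn0 => /eqP ->.
by move=> /(_ 0%N isT)[].
Qed.

Lemma law_first_jump0 n m : (r <= n)%N -> q n m = 0 ->
  L n [set w | (w 0%N).1 = n /\ (w 1%N).1 = m] = 0%E.
Proof.
move=> rn qnm.
have -> : [set w : chain_path R | (w 0%N).1 = n /\ (w 1%N).1 = m] =
    cylinder 1 (fun k => if k is 0%N then n else m) (cst setT).
  apply/seteqP; split=> w /=; first by move=> [w0 w1] [|[|]].
  by move=> H; split; [have [] := H 0%N isT|have [] := H 1%N isT].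
rewrite lawL => [||k]; last exact: measurableT; last by [].
by rewrite big_ord_recl/= jump_probE qnm !mul0r mulr0 mul0e.
Qed.

Lemma measurable_first_jump n m (A : set (measurableTypeR R * chain_path R)) (t : R) :
  measurable A ->
  measurable ([set w | [/\ (w 0%N).1 = n, (w 1%N).1 = m &
                 A (t - holding 0 w, path_tail w)]] : set (chain_path R)).
Proof.
move=> mA.
have mf : measurable_fun setT (fun w : chain_path R =>
    (t - holding 0 w : measurableTypeR R, path_tail w)).
  apply/measurable_fun_pairP; split; last exact: measurable_path_tail.
  by apply: measurable_funB => //; exact: measurable_holding.
rewrite (_ : mkset _ = [set w | (w 0%N).1 = n] `&` [set w | (w 1%N).1 = m] `&`
  ((fun w => (t - holding 0 w, path_tail w)) @^-1` A)); last first.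
  by apply/seteqP; split=> w /=; [case|case=> -[]].
apply: measurableI; first by apply: measurableI; exact: measurable_state.
by rewrite -[X in measurable X]setTI; exact: mf.
Qed.

(** The variable u is the time left after the jump. Its range is [0, t]: above t the exponential
    density vanishes, below 0 the sections of A are null by assumption. *)
Lemma law_jump n m (A : set (measurableTypeR R * chain_path R)) (t : R) :
  (r <= n)%N -> measurable A ->
  (forall u, u < 0 -> L m (xsection A u) = 0%E) ->
  L n [set w | [/\ (w 0%N).1 = n, (w 1%N).1 = m &
                 A (t - holding 0 w, path_tail w)]] =
  ((jump_prob q n m)%:E * \int[leb]_(u in `[0%R, t])
    ((exit_rate q n * expR (- exit_rate q n * (t - u)))%:E *
      L m (xsection A u)))%E.
Proof.
move=> rn mA A0.
(* If the rate is 0, m may lie below r, where nothing is known about [L m]; the jump itself then has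
   probability 0. *)
have [qnm0|qnm0] := eqVneq (q n m) 0.
  rewrite jump_probE qnm0 mul0r mul0e; apply/eqP; rewrite -measure_le0.
  rewrite -(law_first_jump0 rn qnm0); apply: le_measure; rewrite ?inE.
  - exact: measurable_first_jump.
  - exact: measurableI (measurable_state 0 n) (measurable_state 1 m).
  - by move=> w [].
have /andP[rm _] := q_supp rn qnm0.
pose C : set (measurableTypeR R * chain_path R) := [set z | A (t - z.1, z.2)].
have mC : measurable C.
  have mf : measurable_fun setT (fun z : measurableTypeR R * chain_path R =>
      (t - z.1 : measurableTypeR R, z.2)).
    apply/measurable_fun_pairP; split; last exact: measurable_snd.
    by apply: (@measurable_funB _ (measurableTypeR R * chain_path R)%type R setT (cst t) fst) => //.
  by rewrite -[X in measurable X]setTI; exact: mf.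
rewrite (first_step (exit_gt0 rn) (jump_prob_ge0 m rn) (lawL rn) (lawL rm) mC).
congr (_ * _)%E.
rewrite expo_product_integral//.
pose f u := ((exponential_pdf (exit_rate q n) (t - u))%:E * L m (xsection A u))%E.
transitivity (\int[leb]_x f (t - x)%R)%E.
  by apply: eq_integral => x _; rewrite /f subKr.
rewrite ge0_integral_reflect//; last 2 first.
- apply: emeasurable_funM; last exact: measurable_fun_xsection.
  apply/measurable_EFinP; apply: measurableT_comp => //.
    exact: measurable_exponential_pdf.
  exact: measurable_funB.
- move=> x; apply: mule_ge0 => //.
  by rewrite lee_fin exponential_pdf_ge0// ltW// exit_gt0.
rewrite [RHS]integral_mkcond; apply: eq_integral => u _.
rewrite patchE mem_setE in_itv/= /f; case: ifPn => [/andP[u0 ut]|].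
  by rewrite exponential_pdfE ?subr_ge0.
rewrite negb_and -!ltNge => /orP[u0|ut]; first by rewrite A0// mule0.
by rewrite lt0_exponential_pdf ?mul0e// subr_lt0.
Qed.


Lemma probability_setI1 d (T : measurableType d) (P : probability T R)
    (A E : set T) : measurable A -> measurable E -> P E = 1%E ->
  P (A `&` E) = P A.
Proof.
move=> mA mE PE; rewrite [RHS](measureDI _ mA mE).
rewrite [X in _ = (X + _)%E](_ : _ = 0%E) ?add0e//.
apply/eqP; rewrite -measure_le0.
have <- : P (~` E) = 0%E by rewrite probability_setC// PE subee.
apply: le_measure; rewrite ?inE//.
- exact: measurableD.
- exact: measurableC.
Qed.

(* [A (s, _)] is the event that has to occur within time s after the first
   jump for [D] to occur within time t. *)
Lemma renewal n (D : set (chain_path R)) (A : set (measurableTypeR R * chain_path R))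
    (t : R) : (r <= n)%N -> measurable D -> measurable A ->
  (forall m u, u < 0 -> L m (xsection A u) = 0%E) ->
  (forall w, (w 0%N).1 = n -> D w <-> A (t - holding 0 w, path_tail w)) ->
  L n D =
  (\int[leb]_(u in `[0%R, t])
    (exit_rate q n * expR (- exit_rate q n * (t - u)) *
      \sum_(m < n.+2) jump_prob q n m * fine (L m (xsection A u)))%:E)%E.
Proof.
move=> rn mD mA A0 DA.
pose G m : set (chain_path R) := [set w | [/\ (w 0%N).1 = n, (w 1%N).1 = m &
                 A (t - holding 0 w, path_tail w)]].
have mG m : measurable (G m) by exact: measurable_first_jump.
have -> : L n D = L n (\bigcup_m G m).
  rewrite (_ : \bigcup_m G m = D `&` [set w | (w 0%N).1 = n]); last first.
    apply/seteqP; split=> [w [m _ [w0 _ Aw]]|w [Dw w0]].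
      by split => //; apply/DA.
    by exists (w 1%N).1 => //; split => //; exact/DA.
  rewrite probability_setI1 ?law_init//; exact: measurable_state.
rewrite measure_semi_bigcup//; first last.
- exact: bigcupT_measurable.
- apply/trivIsetP => i k _ _ ik; apply/seteqP; split=> w //= [[_ wi _] [_ wk _]].
  by move: ik; rewrite -wi -wk eqxx.
have GE m := law_jump t rn mA (A0 m).
(* One jump from n reaches at most n + 1, so the series over the next state is finite. *)
rewrite (nneseries_split _ n.+2)//= [X in (_ + X)%E]eseries0 ?adde0; last first.
  move=> m nm _; rewrite /G GE jump_probE.
  have [->|/(q_supp rn)/andP[_]] := eqVneq (q n m) 0; first by rewrite mul0r mul0e.
  by rewrite leqNgt nm.
pose f m u := ((exit_rate q n * expR (- exit_rate q n * (t - u)))%:E *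
                 (jump_prob q n m * fine (L m (xsection A u)))%:E)%E.
have q0 : 0 <= exit_rate q n by rewrite ltW// exit_gt0.
have f0 m u : (0 <= f m u)%E.
  by rewrite mule_ge0// lee_fin mulr_ge0 ?expR_ge0// ?fine_ge0// jump_prob_ge0.
have mL m : measurable_fun setT (fun u : measurableTypeR R => fine (L m (xsection A u))).
  by apply: measurableT_comp => //; exact: measurable_fun_xsection.
have me : measurable_fun setT
    (fun u : R => exit_rate q n * expR (- exit_rate q n * (t - u))).
  apply: measurable_funM => //; apply: measurableT_comp => //.
  by apply: measurable_funM => //; exact: measurable_funB.
have mf m : measurable_fun setT (f m).
  apply: emeasurable_funM; apply/measurable_EFinP => //.
  by apply: (measurable_funM _ (mL m)).
transitivity (\sum_(m < n.+2) \int[leb]_(u in `[0%R, t]) f m u)%E.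
  rewrite big_mkord; apply: eq_bigr => m _; rewrite /G GE.
  rewrite -ge0_integralZl//; first last.
  - by rewrite lee_fin jump_prob_ge0.
  - by move=> u _; rewrite mule_ge0// lee_fin mulr_ge0 ?expR_ge0.
  - apply: measurable_funTS; apply: emeasurable_funM; first exact/measurable_EFinP.
    exact: measurable_fun_xsection.
  apply: eq_integral => u _; rewrite /f (EFinM (jump_prob q n m)).
  rewrite (@fineK _ (L m _)); first by rewrite muleCA.
  by rewrite fin_num_measure//; exact: measurable_xsection.
rewrite -ge0_integral_sum//; last by move=> m; apply: measurable_funTS; exact: mf.
by apply: eq_integral => u _; rewrite mulr_sumr -sumEFin.
Qed.

(** The event that k is visited by time t, read off the jump chain: k can only be entered at time 0
    or at a jump time, so a countable union replaces the infimum over real times. *)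
Definition hit_by (k : nat) (t : R) : set (chain_path R) :=
  [set w | exists i, (w i).1 = k /\ jump_time i w <= t].

Hypothesis L_pos : forall n, L n [set w | forall i, 0 < holding i w] = 1%E.

Lemma measurable_positive :
  measurable ([set w | forall i, 0 < holding i w] : set (chain_path R)).
Proof.
rewrite (_ : mkset _ = \bigcap_i (holding i @^-1` `]0, +oo[)); last first.
  apply/seteqP; split=> w /= H i; first by move=> _; rewrite /= in_itv/= H.
  by have := H i I; rewrite /= in_itv/= andbT.
apply: bigcapT_measurable => i.
by rewrite -[X in measurable X]setTI; exact: measurable_holding.
Qed.

(** Holding times are positive almost surely; this supplies the null sections at negative times that
    [renewal] asks for. *)
Lemma negligible_before n (D : set (chain_path R)) : measurable D ->
  (forall w, (forall i, 0 <= holding i w) -> ~ D w) -> L n D = 0%E.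
Proof.
move=> mD D0; rewrite -(probability_setI1 mD measurable_positive (L_pos n)).
rewrite (_ : _ `&` _ = set0) ?measure0//; apply/seteqP; split=> // w [Dw w0].
by apply: (D0 w) => // i; exact: ltW.
Qed.

Lemma jump_time_ge0 i (w : chain_path R) :
  (forall i, 0 <= holding i w) -> 0 <= jump_time i w.
Proof. by move=> w0; apply: sumr_ge0 => m _. Qed.

(** Time and path are taken jointly, so that measurability in the product yields measurability in u
    of the probabilities of the sections. *)
Definition jump_time_graph i : set (measurableTypeR R * chain_path R) :=
  [set z | jump_time i z.2 <= z.1].

Lemma measurable_jump_time_graph i : measurable (jump_time_graph i).
Proof.
have mf : measurable_fun setT (fun z : measurableTypeR R * chain_path R =>
    z.1 - jump_time i z.2).
  apply: (@measurable_funB _ (measurableTypeR R * chain_path R)%type R setT fst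
    (jump_time i \o snd)) => //.
  by apply: measurableT_comp => //; exact: measurable_jump_time.
rewrite (_ : jump_time_graph i = (fun z => z.1 - jump_time i z.2) @^-1` `[0, +oo[).
  by rewrite -[X in measurable X]setTI; exact: mf.
by apply/seteqP; split=> z /=; rewrite /jump_time_graph/= in_itv/= andbT subr_ge0.
Qed.

Definition hit_graph k : set (measurableTypeR R * chain_path R) :=
  [set z | hit_by k z.1 z.2].

Lemma measurable_hit_graph k : measurable (hit_graph k).
Proof.
rewrite (_ : hit_graph k =
    \bigcup_i ((setT `*` [set w | (w i).1 = k]) `&` jump_time_graph i)).
  apply: bigcupT_measurable => i; apply: measurableI.
    by apply: measurableX => //; exact: measurable_state.
  exact: measurable_jump_time_graph.
apply/seteqP; split=> [z [i [zi ti]]|z [i _ [[_ zi] ti]]]; last by exists i.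
by exists i.
Qed.

Lemma xsection_hit_graph k u : xsection (hit_graph k) u = hit_by k u.
Proof. by apply/seteqP; split=> w => [/xsectionP|?]; last exact/xsectionP. Qed.

Lemma xsection_jump_time_graph i u :
  xsection (jump_time_graph i) u = [set w | jump_time i w <= u].
Proof. by apply/seteqP; split=> w => [/xsectionP|?]; last exact/xsectionP. Qed.

Lemma measurable_hit_by k u : measurable (hit_by k u).
Proof.
by rewrite -xsection_hit_graph; apply: measurable_xsection; exact: measurable_hit_graph.
Qed.

Lemma measurable_jump_time_le i u :
  measurable ([set w | jump_time i w <= u] : set (chain_path R)).
Proof.
rewrite -xsection_jump_time_graph; apply: measurable_xsection.
exact: measurable_jump_time_graph.
Qed.

Lemma jump_time_le_renewal i n t : (r <= n)%N ->
  L n [set w | jump_time i.+1 w <= t] =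
  (\int[leb]_(u in `[0%R, t])
    (exit_rate q n * expR (- exit_rate q n * (t - u)) *
      \sum_(m < n.+2) jump_prob q n m * fine (L m [set w | (jump_time i w <= u)%R]))%:E)%E.
Proof.
move=> rn; under eq_integral do under eq_bigr do rewrite -xsection_jump_time_graph.
apply: renewal => //.
- exact: measurable_jump_time_le.
- exact: measurable_jump_time_graph.
- move=> m u u0; rewrite xsection_jump_time_graph.
  apply: negligible_before; first exact: measurable_jump_time_le.
  by move=> w w0 /=; apply/negP; rewrite -ltNge (lt_le_trans u0)// jump_time_ge0.
- by move=> w _; rewrite /jump_time_graph/= jump_timeS lerBrDl.
Qed.

(** Since n differs from k, a visit to k needs at least one jump; dropping that jump lowers its
    index by one and the time allowed by the first holding time. *)
Lemma hit_by_renewal k n t : (r <= n)%N -> n != k ->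
  L n (hit_by k t) =
  (\int[leb]_(u in `[0%R, t])
    (exit_rate q n * expR (- exit_rate q n * (t - u)) *
      \sum_(m < n.+2) jump_prob q n m * fine (L m (hit_by k u)))%:E)%E.
Proof.
move=> rn nk; under eq_integral do under eq_bigr do rewrite -xsection_hit_graph.
apply: renewal => //.
- exact: measurable_hit_by.
- exact: measurable_hit_graph.
- move=> m u u0; rewrite xsection_hit_graph.
  apply: negligible_before; first exact: measurable_hit_by.
  move=> w w0 [i [_]]; apply/negP.
  by rewrite -ltNge (lt_le_trans u0)// jump_time_ge0.
- move=> w wn; split=> [[[|i] [wk wt]]|[i [wk wt]]].
  + by move: nk; rewrite -wn wk eqxx.
  + by exists i; split => //; rewrite lerBrDl -jump_timeS.
  + by exists i.+1; split => //; rewrite jump_timeS -lerBrDl.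
Qed.

Lemma hit_by_self k t : (r <= k)%N -> 0 <= t -> L k (hit_by k t) = 1%E.
Proof.
move=> rk t0; apply/eqP; rewrite eq_le; apply/andP; split.
  by apply: probability_le1; exact: measurable_hit_by.
rewrite -(law_init rk); apply: le_measure; rewrite ?inE.
- exact: measurable_state.
- exact: measurable_hit_by.
- by move=> w wk; exists 0%N; split => //; rewrite /jump_time big_ord0.
Qed.

End renewal.

(** * Laplace transforms and the convolution equation *)

Section laplace.
Context {R : realType}.
Local Notation leb := (@lebesgue_measure R).
Implicit Types (l a u : R) (f g h phi : R -> R).

Definition laplace l f : \bar R :=
  (\int[leb]_(t in `[0%R, +oo[) (expR (- l * t) * f t)%:E)%E.

Lemma measurable_expR_affine (l c : R) :
  measurable_fun setT (fun t : R => expR (- l * (c - t))).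
Proof.
apply: measurableT_comp => //; apply: measurable_funM => //.
exact: measurable_funB.
Qed.

Lemma measurable_laplace_integrand l f (D : set R) : measurable_fun setT f ->
  measurable_fun D (fun t => (expR (- l * t) * f t)%:E).
Proof.
move=> mf; apply/measurable_EFinP; apply: measurable_funTS.
by apply: measurable_funM => //; exact: measurableT_comp.
Qed.

Lemma laplace_ge0 l f : (forall t, 0 <= t -> 0 <= f t) -> (0 <= laplace l f)%E.
Proof.
move=> f0; apply: integral_ge0 => t; rewrite /= in_itv/= andbT => t0.
by rewrite lee_fin mulr_ge0 ?expR_ge0// f0.
Qed.

Lemma laplace1 l : 0 < l -> laplace l (cst 1%R) = (l^-1)%:E.
Proof.
move=> l0.
have H : (l%:E * laplace l (cst 1%R) = 1)%E.
  rewrite -(integral_exponential_pdf l0) /laplace -ge0_integralZl//; first last.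
  - by rewrite lee_fin ltW.
  - by move=> t _; rewrite lee_fin mulr1 expR_ge0.
  - exact: measurable_laplace_integrand.
  rewrite integral_mkcond; apply: eq_integral => t _.
  rewrite /exponential_pdf !patchE; case: ifP => // _.
  by rewrite mulr1 -EFinM.
have : (l^-1%:E * (l%:E * laplace l (cst 1%R)) = l^-1%:E)%E by rewrite H mule1.
by rewrite muleA -EFinM mulVf ?gt_eqF// mul1e.
Qed.

Lemma le_laplace l f g : measurable_fun setT f -> measurable_fun setT g ->
  (forall t, 0 <= t -> 0 <= f t <= g t) -> (laplace l f <= laplace l g)%E.
Proof.
move=> mf mg fg; apply: ge0_le_integral => //.
- move=> t; rewrite /= in_itv/= andbT => /fg/andP[ft _].
  by rewrite lee_fin mulr_ge0 ?expR_ge0.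
- exact: measurable_laplace_integrand.
- exact: measurable_laplace_integrand.
- move=> t; rewrite /= in_itv/= andbT => /fg/andP[_ ft].
  by rewrite lee_fin ler_wpM2l ?expR_ge0.
Qed.

Lemma laplace_le l f : 0 < l -> measurable_fun setT f ->
  (forall t, 0 <= t -> 0 <= f t <= 1) -> (laplace l f <= (l^-1)%:E)%E.
Proof. by move=> l0 mf f01; rewrite -(laplace1 l0); exact: le_laplace. Qed.

Lemma laplace_fin_num l f : 0 < l -> measurable_fun setT f ->
  (forall t, 0 <= t -> 0 <= f t <= 1) -> laplace l f \is a fin_num.
Proof.
move=> l0 mf f01; rewrite ge0_fin_numE.
  by apply: le_lt_trans (ltry l^-1); exact: laplace_le.
by apply: laplace_ge0 => t /f01/andP[].
Qed.

Lemma integrable_laplace l f : 0 < l -> measurable_fun setT f ->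
  (forall t, 0 <= t -> 0 <= f t <= 1) ->
  leb.-integrable `[0, +oo[ (fun t => (expR (- l * t) * f t)%:E).
Proof.
move=> l0 mf f01; apply/integrableP; split.
  exact: measurable_laplace_integrand.
apply: le_lt_trans (ltry l^-1); apply: le_trans (laplace_le l0 mf f01).
rewrite le_eqVlt; apply/orP; left; apply/eqP; apply: eq_integral => t.
rewrite mem_setE in_itv/= andbT => /f01/andP[ft _].
by rewrite ger0_norm// mulr_ge0 ?expR_ge0.
Qed.

Lemma laplace_sum l n (p : 'I_n -> R) (f : 'I_n -> R -> R) :
  (forall m, measurable_fun setT (f m)) ->
  (forall m t, 0 <= f m t) -> (forall m, 0 <= p m) ->
  laplace l (fun t => \sum_(m < n) p m * f m t) =
  (\sum_(m < n) (p m)%:E * laplace l (f m))%E.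
Proof.
move=> mf f0 p0.
transitivity (\sum_(m < n) \int[leb]_(t in `[0%R, +oo[)
    ((p m)%:E * (expR (- l * t) * f m t)%:E))%E; last first.
  apply: eq_bigr => m _; rewrite ge0_integralZl//.
  - exact: measurable_laplace_integrand.
  - by move=> t _; rewrite lee_fin mulr_ge0 ?expR_ge0.
  - by rewrite lee_fin.
rewrite -ge0_integral_sum//; first last.
- by move=> m t _; rewrite -EFinM lee_fin !mulr_ge0 ?expR_ge0.
- move=> m; apply: measurable_funeM; exact: measurable_laplace_integrand.
apply: eq_integral => t _; rewrite mulr_sumr -sumEFin.
by apply: eq_bigr => m _; rewrite -EFinM mulrCA.
Qed.

Lemma ge0_integral_translate (f : R -> \bar R) (u : R) :
  measurable_fun setT f -> (forall x, 0 <= f x)%E ->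
  (\int[leb]_t f (t - u)%R = \int[leb]_t f t)%E.
Proof.
move=> mf f0.
rewrite -(ge0_integral_reflect 0 mf f0).
rewrite -(@ge0_integral_reflect _ (fun x => f (0 - x)) u).
- by apply: eq_integral => t _; rewrite sub0r opprB.
- by apply: (measurableT_comp mf); exact: measurable_funB.
- by move=> x; exact: f0.
Qed.

Section convolution_equation.
Variables (a : R) (h phi : R -> R).
Hypotheses (a0 : 0 < a) (mh : measurable_fun setT h) (h0 : forall u, 0 <= h u).
Hypothesis phiE : forall t, 0 <= t ->
  (phi t)%:E = (\int[leb]_(u in `[0%R, t]) (a * expR (- a * (t - u)) * h u)%:E)%E.

Lemma laplace_convolution l : 0 < l ->
  laplace l phi = ((a / (a + l))%:E * laplace l h)%E.
Proof.
move=> l0.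
have al0 : 0 < a + l by exact: addr_gt0.
(* Tonelli applied to
   e^{-lt} a e^{-a(t-u)} = a/(a+l) e^{-lu} (a+l) e^{-(a+l)(t-u)}. *)
pose G := (fun u => expR (- l * u) * h u) \_ `[0, +oo[.
(* The truncation in [G] and the vanishing of the density at negative arguments confine u to [0, t],
   so both integrals run over the whole line. *)
pose F (z : measurableTypeR R * measurableTypeR R) :=
  (G z.2 * exponential_pdf (a + l) (z.1 - z.2))%:E.
have G0 u : 0 <= G u.
  by rewrite /G patchE; case: ifP => // _; rewrite mulr_ge0 ?expR_ge0.
have mG : measurable_fun setT G.
  apply/measurable_restrict => //; apply: measurable_funTS.
  by apply: measurable_funM => //; exact: measurableT_comp.
have F0 z : (0 <= F z)%E.
  by rewrite lee_fin mulr_ge0// exponential_pdf_ge0// ltW.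
have mpdf := measurable_exponential_pdf (a + l).
have mF : measurable_fun setT F.
  apply/measurable_EFinP; apply: measurable_funM.
    by apply: measurableT_comp.
  by apply: measurableT_comp => //; exact: measurable_funB.
transitivity (\int[leb]_t ((a / (a + l))%:E * \int[leb]_u F (t, u)))%E.
  rewrite /laplace integral_mkcond; apply: eq_integral => t _.
  rewrite patchE mem_setE in_itv/= andbT; case: ifPn => [t0|].
    rewrite EFinM phiE// -ge0_integralZl//; first last.
    - by move=> u _; rewrite lee_fin !mulr_ge0 ?expR_ge0// ltW.
    - apply/measurable_EFinP; apply: measurable_funTS.
      apply: measurable_funM => //; apply: measurable_funM => //.
      exact: measurable_expR_affine.
    rewrite -ge0_integralZl//; first last.
    - by rewrite lee_fin divr_ge0// ltW.
    - exact: (measurableT_comp mF).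
    rewrite integral_mkcond; apply: eq_integral => u _.
    rewrite patchE mem_setE in_itv/= /F/= /G patchE mem_setE in_itv/= andbT.
    have [u0|u0] /= := leP 0 u; last by rewrite mul0r mule0.
    have [ut|tu] := leP u t.
      rewrite exponential_pdfE ?subr_ge0// -!EFinM; congr EFin.
      have eE : expR (- l * t) * expR (- a * (t - u)) =
          expR (- l * u) * expR (- (a + l) * (t - u)).
        by rewrite -!expRD; congr expR; ring.
      transitivity (expR (- l * t) * expR (- a * (t - u)) * (a * h u)); first by ring.
      by rewrite eE; field; rewrite gt_eqF.
    by rewrite lt0_exponential_pdf ?subr_lt0// mulr0 mule0.
  rewrite -ltNge => t0; rewrite integral0_eq ?mule0// => u _.
  rewrite /F/= /G patchE mem_setE in_itv/= andbT.
  case: ifPn => [u0|_]; last by rewrite mul0r.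
  by rewrite lt0_exponential_pdf ?mulr0// subr_lt0 (lt_le_trans t0).
rewrite ge0_integralZl//; first last.
- by rewrite lee_fin divr_ge0// ltW.
- by move=> t _; exact: integral_ge0.
- exact: (measurable_fun_fubini_tonelli_F F).
congr (_ * _)%E.
rewrite (fubini_tonelli F)//.
rewrite /laplace [RHS]integral_mkcond; apply: eq_integral => u _.
transitivity ((G u)%:E * \int[leb]_t (exponential_pdf (a + l) (t - u))%:E)%E.
  rewrite -ge0_integralZl//.
  - apply/measurable_EFinP; apply: measurableT_comp => //; exact: measurable_funB.
  - by move=> t _; rewrite lee_fin exponential_pdf_ge0// ltW.
  - by rewrite lee_fin.
rewrite (ge0_integral_translate (f := fun x => (exponential_pdf (a + l) x)%:E)).
- by rewrite integral_exponential_pdf// mule1 /G !patchE; case: ifP.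
- exact/measurable_EFinP.
- by move=> x; rewrite lee_fin exponential_pdf_ge0// ltW.
Qed.

Hypothesis h1 : forall u, h u <= 1.

(** Factoring e^{-at} out of the convolution leaves an integrand independent of t, to which the
    fundamental theorem of calculus applies. *)
Let f u := a * expR (a * u) * h u.
Let F := fun x => (\int[leb]_(t in `[0%R, x]) f t)%R.

Let intf T : leb.-integrable `[0, T] (EFin \o f).
Proof.
apply: measurable_bounded_integrable => //.
- by rewrite /= lebesgue_measure_itv/=; case: ifP => _; rewrite -?EFinB ltry.
- apply: measurable_funTS; apply: measurable_funM => //.
  by apply: measurable_funM => //; exact: measurableT_comp.
- exists (a * expR (a * T)); split; first exact: num_real.
  move=> M TM u /=; rewrite in_itv/= => /andP[u0 uT].
  have a0' := ltW a0.
  rewrite ger0_norm; last by rewrite !mulr_ge0 ?expR_ge0.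
  apply: le_trans (ltW TM); rewrite -[leRHS]mulr1.
  apply: ler_pM => //; first by rewrite mulr_ge0 ?expR_ge0.
  by rewrite ler_pM2l// ler_expR ler_pM2l.
Qed.

Let phi_integral t : 0 <= t -> phi t = expR (- a * t) * F t.
Proof.
move=> t0; rewrite /F -RintegralZl//; apply: EFin_inj.
rewrite phiE// /Rintegral fineK.
  apply: eq_integral => u _; rewrite /f; congr EFin.
  rewrite (_ : - a * (t - u) = - a * t + a * u); last by ring.
  by rewrite expRD; ring.
apply: integrable_fin_num => //.
exact: (integrableZl _ _ (intf t)).
Qed.

Let near_phi (x : R) : 0 < x -> \forall t \near x, expR (- a * t) * F t = phi t.
Proof.
by move=> x0; near=> t; rewrite phi_integral//; apply: ltW; near: t; exact: lt_nbhsr.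
Unshelve. all: by end_near. Qed.

Let is_derive_expRM (c x : R) :
  is_derive x 1 (fun t => expR (c * t)) (c * expR (c * x)).
Proof.
have H : is_derive x 1 (fun t : R => c * t) c.
  by apply: is_derive_eq; exact: mulr1.
by have := is_derive1_comp (is_derive_expR (c * x)) H; rewrite mulrC.
Qed.

Let continuous_expRM (c : R) : continuous (fun t => expR (c * t)).
Proof.
move=> x; apply: differentiable_continuous; apply/derivable1_diffP.
by have [] := is_derive_expRM c x.
Qed.

Lemma convolution_continuous (x : R) : 0 < x -> {for x, continuous phi}.
Proof.
move=> x0.
(* The endpoint x + 1 serves only to place x in the interior of the interval of integration. *)
have x10 : 0 < x + 1 by exact: addr_gt0.
have cF : {for x, continuous F}.
  have := parameterized_integral_continuous (ltW x10) (intf (x + 1)).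
  move=> /(continuous_within_itvP _ x10)[+ _ _]; apply.
  by rewrite in_itv/= x0 ltrDl ltr01.
rewrite /prop_for /continuous_at phi_integral ?ltW//.
apply: cvg_trans; first exact: (near_eq_cvg (near_phi x0)).
by apply: cvgM; [exact: continuous_expRM|exact: cF].
Qed.

(** The product rule for e^{-at} times the integral of a e^{au} h(u). *)
Lemma convolution_derive (x : R) : 0 < x -> {for x, continuous h} ->
  is_derive x 1 phi (a * (h x - phi x)).
Proof.
move=> x0 ch.
have xx1 : x < x + 1 by rewrite ltrDl ltr01.
have cf : {for x, continuous f}.
  apply: cvgM => //; apply: cvgM; first exact: cvg_cst.
  exact: continuous_expRM.
have [dF F'] := continuous_FTC1_closed xx1 (intf (x + 1)) x0 cf.
apply: near_eq_is_derive; first exact: near_phi.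
have dF' : is_derive x 1 F (f x) by split=> //; rewrite -F' derive1E.
have := is_deriveM (is_derive_expRM (- a) x) dF'.
move/is_derive_eq; apply.
rewrite phi_integral ?ltW// /f /GRing.scale/= [in RHS]mulrBr.
have -> : expR (- a * x) * (a * expR (a * x) * h x) =
  (expR (- a * x) * expR (a * x)) * (a * h x) by ring.
by rewrite -expRD mulNr addNr expR0; ring.
Qed.

(** No integration by parts: the derivative is a (h - phi), and the transform of h is (a + l) / a
    times that of phi, so the difference collapses to l times the transform of phi. *)
Lemma laplace_convolution_derive l : 0 < l -> measurable_fun setT phi ->
  (forall t, 0 <= t -> 0 <= phi t <= 1) ->
  (forall x : R, 0 < x -> {for x, continuous h}) ->
  (\int[leb]_(t in `[0%R, +oo[) (expR (- l * t) * derive1 phi t))%R =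
  l * fine (laplace l phi).
Proof.
move=> l0 mphi phi01 ch.
have h01 t : 0 <= t -> 0 <= h t <= 1 by rewrite h0 h1.
have D t : 0 < t -> derive1 phi t = a * (h t - phi t).
  by move=> t0; have [_ <-] := convolution_derive t0 (ch _ t0); rewrite derive1E.
pose g t := a * (expR (- l * t) * h t) - a * (expR (- l * t) * phi t).
have mg : measurable_fun setT g.
  apply: measurable_funB; apply: measurable_funM => //; apply: measurable_funM => //;
    by exact: measurableT_comp.
have gE : {in `]0, +oo[, g =1 (fun t => expR (- l * t) * derive1 phi t)}.
  by move=> t; rewrite in_itv/= andbT => t0; rewrite D// /g; ring.
(* The point 0 is removed, because the differential equation for [phi] is available only at positive
   times. *)
rewrite /Rintegral -integral_itv_obnd_cbnd; last first.
  apply/measurable_EFinP; apply: eq_measurable_fun (measurable_funTS mg).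
  by move=> t; rewrite inE => /gE.
transitivity (fine (\int[leb]_(t in `]0%R, +oo[) (g t)%:E)%E).
  by congr fine; apply: eq_integral => t; rewrite inE => /gE /= <-.
rewrite integral_itv_obnd_cbnd; last exact/measurable_EFinP/measurable_funTS.
have ih := integrable_laplace l0 mh h01.
have ip := integrable_laplace l0 mphi phi01.
transitivity (fine (\int[leb]_(t in `[0%R, +oo[)
    (a%:E * (expR (- l * t) * h t)%:E - a%:E * (expR (- l * t) * phi t)%:E))%E).
  by congr fine; apply: eq_integral => t _; rewrite /g EFinB !EFinM.
rewrite integralB//; try exact: integrableZl.
rewrite !integralZl// -!/(laplace _ _) laplace_convolution//.
have := laplace_fin_num l0 mh h01; case: (laplace l h) => // x _.
rewrite -!EFinM -EFinB/=; field.
by rewrite gt_eqF// addr_gt0.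
Qed.

End convolution_equation.
End laplace.

(** * The linear system for the transforms, and uniqueness of its bounded solutions *)

Section chain_transform.
Context {R : realType}.
Local Notation leb := (@lebesgue_measure R).
Variables (r : nat) (q : nat -> nat -> R).
Hypothesis q_ge0 : forall n m, 0 <= q n m.
Hypothesis qnn : forall n, q n n = 0.
Hypothesis q_supp : forall n m, (r <= n)%N -> q n m != 0 -> (r <= m <= n.+1)%N.
Hypothesis exit_gt0 : forall n, (r <= n)%N -> 0 < exit_rate q n.
Hypothesis exitE : forall n, (r <= n)%N -> exit_rate q n = \sum_(m < n.+2) q n m.
Variable L : nat -> probability (chain_path R) R.
Hypothesis lawL : forall n, (r <= n)%N -> chain_law q n (L n).
Hypothesis L_pos : forall n, L n [set w | forall i, 0 < holding i w] = 1%E.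

(* E[e^{-lT}] when f is the distribution function of a time T >= 0. *)
Definition transform (l : R) (f : R -> R) : R := l * fine (laplace l f).

Lemma transform_ge0 l (f : R -> R) : 0 < l -> (forall t, 0 <= t -> 0 <= f t) ->
  0 <= transform l f.
Proof. by move=> l0 f0; rewrite mulr_ge0 ?fine_ge0 ?laplace_ge0// ltW. Qed.

Lemma transform_le1 l (f : R -> R) : 0 < l -> measurable_fun setT f ->
  (forall t, 0 <= t -> 0 <= f t <= 1) -> transform l f <= 1.
Proof.
move=> l0 mf f01; rewrite /transform -ler_pdivlMl// mulr1.
by rewrite -lee_fin fineK ?laplace_fin_num// laplace_le.
Qed.

Definition mean_cdf n (psi : nat -> R -> R) u :=
  \sum_(m < n.+2) jump_prob q n m * psi m u.

Lemma jump_prob_sum n : (r <= n)%N -> \sum_(m < n.+2) jump_prob q n m = 1.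
Proof.
move=> rn; under eq_bigr do rewrite jump_probE//.
by rewrite -mulr_suml -exitE// mulfV// gt_eqF// exit_gt0.
Qed.

Section mean.
Variables (n : nat) (psi : nat -> R -> R).
Hypotheses (rn : (r <= n)%N) (mpsi : forall m, measurable_fun setT (psi m)).
Hypothesis psi01 : forall m t, 0 <= psi m t <= 1.

Lemma mean_cdf_ge0 u : 0 <= mean_cdf n psi u.
Proof.
apply: sumr_ge0 => m _; rewrite mulr_ge0//.
  exact: (jump_prob_ge0 q_ge0 qnn exit_gt0).
by have /andP[] := psi01 m u.
Qed.

Lemma mean_cdf_le1 u : mean_cdf n psi u <= 1.
Proof.
rewrite -(jump_prob_sum rn); apply: ler_sum => m _.
rewrite ler_piMr//; last by have /andP[] := psi01 m u.
exact: (jump_prob_ge0 q_ge0 qnn exit_gt0).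
Qed.

Lemma measurable_mean_cdf : measurable_fun setT (mean_cdf n psi).
Proof. by apply: measurable_sum => m; exact: measurable_funM. Qed.

Variable phi : R -> R.
Hypothesis phiE : forall t, 0 <= t -> (phi t)%:E =
  (\int[leb]_(u in `[0%R, t])
    (exit_rate q n * expR (- exit_rate q n * (t - u)) * mean_cdf n psi u)%:E)%E.

(** The transformed renewal equation with its denominator cleared; exit rate times jump probability
    is the rate [q n m]. It serves both for visits and for jump times. *)
Lemma transform_step l : 0 < l ->
  (l + exit_rate q n) * transform l phi = \sum_(m < n.+2) q n m * transform l (psi m).
Proof.
move=> l0; have a0 := exit_gt0 rn.
have E := laplace_convolution a0 measurable_mean_cdf mean_cdf_ge0 phiE l0.
rewrite laplace_sum// in E; last 2 first.
- by move=> m t; have /andP[] := psi01 m t.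
- by move=> m; exact: (jump_prob_ge0 q_ge0 qnn exit_gt0).
have {}E : laplace l phi = (exit_rate q n / (exit_rate q n + l) *
    \sum_(m < n.+2) jump_prob q n m * fine (laplace l (psi m)))%:E.
  rewrite E [in RHS]EFinM -sumEFin; congr (_ * _)%E; apply: eq_bigr => m _.
  by rewrite EFinM fineK// laplace_fin_num.
rewrite /transform E/=.
under eq_bigr do rewrite jump_probE// mulrAC.
rewrite -mulr_suml.
transitivity (l * \sum_(m < n.+2) q n m * fine (laplace l (psi m))).
  by field; rewrite !gt_eqF// addr_gt0.
by rewrite mulr_sumr; apply: eq_bigr => m _; rewrite mulrCA.
Qed.

End mean.

Lemma probability_fine01 d (T : measurableType d) (P : probability T R) A :
  measurable A -> 0 <= fine (P A) <= 1.
Proof.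
move=> mA; apply/andP; split; first by rewrite fine_ge0.
by rewrite -lee_fin fineK; [exact: probability_le1|exact: fin_num_measure].
Qed.

Definition hit_cdf k n t : R := fine (L n (hit_by k t)).
Definition jump_cdf i n t : R := fine (L n [set w | jump_time i w <= t]).

Lemma hit_cdf01 k n t : 0 <= hit_cdf k n t <= 1.
Proof. by apply: probability_fine01; exact: measurable_hit_by. Qed.

Lemma jump_cdf01 i n t : 0 <= jump_cdf i n t <= 1.
Proof. by apply: probability_fine01; exact: measurable_jump_time_le. Qed.

Lemma measurable_hit_cdf k n : measurable_fun setT (hit_cdf k n).
Proof.
apply: measurableT_comp => //.
rewrite (_ : (fun t => L n (hit_by k t)) = L n \o xsection (hit_graph k)).
  by apply: measurable_fun_xsection; exact: measurable_hit_graph.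
by apply/funext => t; rewrite /= xsection_hit_graph.
Qed.

Lemma measurable_jump_cdf i n : measurable_fun setT (jump_cdf i n).
Proof.
apply: measurableT_comp => //.
rewrite (_ : (fun t => L n [set w | jump_time i w <= t]) =
  L n \o xsection (jump_time_graph i)).
  by apply: measurable_fun_xsection; exact: measurable_jump_time_graph.
by apply/funext => t; rewrite /= xsection_jump_time_graph.
Qed.

Lemma hit_cdfE k n t : (r <= n)%N -> n != k -> 0 <= t -> (hit_cdf k n t)%:E =
  (\int[leb]_(u in `[0%R, t])
    (exit_rate q n * expR (- exit_rate q n * (t - u)) * mean_cdf n (hit_cdf k) u)%:E)%E.
Proof.
move=> rn nk t0; rewrite fineK ?fin_num_measure//; last exact: measurable_hit_by.
by rewrite (hit_by_renewal q_ge0 qnn q_supp exit_gt0 lawL L_pos).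
Qed.

Lemma jump_cdfE i n t : (r <= n)%N -> 0 <= t -> (jump_cdf i.+1 n t)%:E =
  (\int[leb]_(u in `[0%R, t])
    (exit_rate q n * expR (- exit_rate q n * (t - u)) * mean_cdf n (jump_cdf i) u)%:E)%E.
Proof.
move=> rn t0; rewrite fineK ?fin_num_measure//; last exact: measurable_jump_time_le.
by rewrite (jump_time_le_renewal q_ge0 qnn q_supp exit_gt0 lawL L_pos).
Qed.

Lemma hit_cdf_self k t : (r <= k)%N -> 0 <= t -> hit_cdf k k t = 1.
Proof. by move=> rk t0; rewrite /hit_cdf (hit_by_self exit_gt0 lawL). Qed.

(** At n = k there is no renewal equation, but the function is constantly 1 on positive times. *)
Lemma continuous_hit_cdf k n (x : R) : (r <= n)%N -> 0 < x ->
  {for x, continuous (hit_cdf k n)}.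
Proof.
move=> rn x0; have [nk|nk] := eqVneq n k.
  move: rn; rewrite nk => rk.
  have near1 : \forall t \near x, (cst 1 : R -> R) t = hit_cdf k k t.
    near=> t; rewrite hit_cdf_self//.
    by apply: ltW; near: t; exact: lt_nbhsr.
  rewrite /prop_for /continuous_at hit_cdf_self ?ltW//.
  by apply: cvg_trans; [exact: (near_eq_cvg near1)|exact: cvg_cst].
apply: (convolution_continuous (exit_gt0 rn) (measurable_mean_cdf n _)
  (mean_cdf_ge0 rn _) (fun t => hit_cdfE rn nk (t := t)) (mean_cdf_le1 rn _)) => //.
- exact: measurable_hit_cdf.
- exact: hit_cdf01.
- exact: hit_cdf01.
Unshelve. all: by end_near. Qed.

(** Differentiating the renewal equation requires its integrand to be continuous. Terms of rate 0
    are treated apart, since they may involve states below r. *)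
Lemma continuous_mean_hit_cdf k n (x : R) : (r <= n)%N -> 0 < x ->
  {for x, continuous (mean_cdf n (hit_cdf k))}.
Proof.
move=> rn x0; apply: cvg_big; first exact: add_continuous.
move=> m _; rewrite jump_probE//.
have [->|qnm] := eqVneq (q n m) 0.
  rewrite !mul0r (_ : (fun=> _) = cst 0); first exact: cvg_cst.
  by apply/funext => u; rewrite mul0r.
apply: cvgM; first exact: cvg_cst.
by have /andP[rm _] := q_supp rn qnm; exact: continuous_hit_cdf.
Qed.

Lemma hit_transform_derive k n l : (r <= n)%N -> n != k -> 0 < l ->
  (\int[leb]_(t in `[0%R, +oo[) (expR (- l * t) * derive1 (hit_cdf k n) t))%R =
  transform l (hit_cdf k n).
Proof.
move=> rn nk l0.
apply: (laplace_convolution_derive (exit_gt0 rn) (measurable_mean_cdf n _)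
  (mean_cdf_ge0 rn _) (fun t => hit_cdfE rn nk (t := t)) (mean_cdf_le1 rn _)) => //.
- exact: measurable_hit_cdf.
- exact: hit_cdf01.
- exact: hit_cdf01.
- exact: measurable_hit_cdf.
- by move=> t _; exact: hit_cdf01.
- by move=> x x0; exact: continuous_mean_hit_cdf.
Qed.

Lemma hit_transform_self k l : (r <= k)%N -> 0 < l -> transform l (hit_cdf k k) = 1.
Proof.
move=> rk l0; rewrite /transform.
rewrite (_ : laplace l _ = laplace l (cst 1%R)); last first.
  apply: eq_integral => t; rewrite mem_setE in_itv/= andbT => t0.
  by rewrite hit_cdf_self.
by rewrite laplace1//= mulfV// gt_eqF.
Qed.

Lemma hit_transform_step k n l : (r <= n)%N -> n != k -> 0 < l ->
  (l + exit_rate q n) * transform l (hit_cdf k n) =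
  \sum_(m < n.+2) q n m * transform l (hit_cdf k m).
Proof.
move=> rn nk l0; apply: transform_step => //.
- exact: measurable_hit_cdf.
- exact: hit_cdf01.
- by move=> t; exact: hit_cdfE.
Qed.

Lemma jump_transform_step i n l : (r <= n)%N -> 0 < l ->
  (l + exit_rate q n) * transform l (jump_cdf i.+1 n) =
  \sum_(m < n.+2) q n m * transform l (jump_cdf i m).
Proof.
move=> rn l0; apply: transform_step => //.
- exact: measurable_jump_cdf.
- exact: jump_cdf01.
- by move=> t; exact: jump_cdfE.
Qed.

Lemma jump_transform0 n l : 0 < l -> transform l (jump_cdf 0 n) = 1.
Proof.
move=> l0; rewrite /transform.
rewrite (_ : laplace l _ = laplace l (cst 1%R)); last first.
  apply: eq_integral => t; rewrite mem_setE in_itv/= andbT => t0.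
  rewrite /jump_cdf (_ : mkset _ = setT) ?probability_setT//.
  by apply/seteqP; split=> w //= _; rewrite /jump_time big_ord0.
by rewrite laplace1//= mulfV// gt_eqF.
Qed.

Section uniqueness.
Hypothesis L_nonexplosive : forall n t, (r <= n)%N -> 0 <= t ->
  L n [set w | forall i, jump_time i w <= t] = 0%E.

(** Continuity from above. The events that the i-th jump time is at most t decrease only almost
    surely, hence the finite intersections [A i], which have the same probabilities. *)
Lemma jump_cdf_cvg0 n t : (r <= n)%N -> 0 <= t ->
  (jump_cdf i n t)%:E @[i --> \oo] --> 0%E.
Proof.
move=> rn t0.
pose A i : set (chain_path R) := \bigcap_(m < i.+1) [set w | jump_time m w <= t].
have mA i : measurable (A i).
  apply: bigcap_measurable; first by exists 0%N.
  by move=> m _; exact: measurable_jump_time_le.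
have AE i : (jump_cdf i n t)%:E = L n (A i).
  rewrite fineK ?fin_num_measure//; last exact: measurable_jump_time_le.
  rewrite -[RHS](probability_setI1 (mA i) (measurable_positive (R := R)) (L_pos n)).
  have mJ := measurable_jump_time_le i t.
  rewrite -(probability_setI1 mJ (measurable_positive (R := R)) (L_pos n)).
  congr (L n _); apply/seteqP; split=> w [wt w0]; split=> //; last first.
    by apply: wt => /=.
  move=> m /= mi; apply: le_trans wt.
  rewrite /jump_time -(subnKC (mi : (m <= i)%N)) big_split_ord/= lerDl.
  by apply: sumr_ge0 => j _; exact: ltW.
under eq_cvg do rewrite AE.
have AT : \bigcap_i A i = [set w | forall i, jump_time i w <= t].
  apply/seteqP; split=> w Aw i; last by move=> _ m _; exact: Aw.
  by apply: (Aw i I i) => /=.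
rewrite -(L_nonexplosive rn t0) -AT.
apply: nonincreasing_cvg_mu => //.
- by apply: le_lt_trans (ltry 1); exact: probability_le1.
- exact: bigcapT_measurable.
- move=> i j ij; apply/subsetPset => w Aw m /= mi.
  by apply: Aw => /=; exact: leq_trans mi _.
Qed.

(** Dominated convergence, with e^{-lt} as the bound. *)
Lemma jump_transform_cvg0 n l : (r <= n)%N -> 0 < l ->
  transform l (jump_cdf i n) @[i --> \oo] --> (0 : R).
Proof.
move=> rn l0.
suff /fine_cvg H : laplace l (jump_cdf i n) @[i --> \oo] --> (0 : R)%:E.
  have := cvgM (cvg_cst l) H; rewrite mulr0.
  by apply.
have -> : (0 : R)%:E = (\int[leb]_(t in `[0%R, +oo[) 0)%E by rewrite integral0.
have m1 := integrable_laplace l0 (@measurable_cst _ _ R R setT (1 : R))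
  (fun t _ => _ : 0 <= 1 <= 1).
apply: (@dominated_cvg _ _ _ leb _ _ _ _ (fun t => (expR (- l * t) * 1)%:E)) => //.
- by move=> i; apply: measurable_laplace_integrand; exact: measurable_jump_cdf.
- move=> t; rewrite /= in_itv/= andbT => t0.
  have := cvgeZl (y := (expR (- l * t))%:E) isT (jump_cdf_cvg0 rn t0).
  by rewrite mule0.
- by apply: m1 => *; rewrite ler01 lexx.
- move=> i t _; have /andP[c0 c1] := jump_cdf01 i n t.
  by rewrite lee_fin ger0_norm ?mulr_ge0 ?expR_ge0// ler_wpM2l ?expR_ge0.
Qed.

Lemma bounded_solution_eq0 k l M (D : nat -> R) : 0 < l ->
  (forall n, (r <= n)%N -> `|D n| <= M) -> D k = 0 ->
  (forall n, (r <= n)%N -> n != k ->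
    (l + exit_rate q n) * D n = \sum_(m < n.+2) q n m * D m) ->
  forall n, (r <= n)%N -> D n = 0.
Proof.
move=> l0 DM Dk Dstep n rn.
have M0 : 0 <= M by exact: le_trans (normr_ge0 _) (DM _ rn).
(* Off k, [D] and the transforms of the jump times obey the same one-step relation with nonnegative
   rates, so the triangle inequality carries the bound from i to i + 1; at k the left side is 0. *)
have le i : forall n, (r <= n)%N -> `|D n| <= M * transform l (jump_cdf i n).
  elim: i => [|i IH] {}n {}rn; first by rewrite jump_transform0// mulr1 DM.
  have T0 j m : 0 <= transform l (jump_cdf j m).
    by apply: transform_ge0 => // t _; have /andP[] := jump_cdf01 j m t.
  have [->|nk] := eqVneq n k; first by rewrite Dk normr0 mulr_ge0.
  have la0 : 0 < l + exit_rate q n by rewrite addr_gt0// exit_gt0.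
  rewrite -(ler_pM2l la0) mulrCA jump_transform_step// -{1}(gtr0_norm la0) -normrM.
  rewrite Dstep// mulr_sumr; apply: le_trans (ler_norm_sum _ _ _) _.
  apply: ler_sum => m _; rewrite normrM (ger0_norm (q_ge0 _ _)) mulrCA.
  have [->|/(q_supp rn)/andP[rm _]] := eqVneq (q n m) 0; first by rewrite !mul0r.
  by rewrite ler_wpM2l// IH.
apply/eqP; rewrite -normr_le0.
have : M * transform l (jump_cdf i n) @[i --> \oo] --> M * 0.
  by apply: cvgM; [exact: cvg_cst|exact: jump_transform_cvg0].
rewrite mulr0 => /cvgr_to_ge; apply.
by near=> i; exact: le.
Unshelve. all: by end_near. Qed.

End uniqueness.

End chain_transform.

(** * From the given processes to laws on path space *)

Section path_law.
Context {R : realType} (d : measure_display) (Omega : measurableType d).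

(** L is the image of P under the path of states and holding times. For the last clause: if all jump
    times are at most t, no holding interval contains t, so X t is no state at all, which has
    probability 0 when the state probabilities sum to 1. *)
Lemma ctmc_path_law (P : probability Omega R) (q : nat -> nat -> R) (j : nat)
    (X : R -> Omega -> option nat) : ctmc_from P q j X ->
  exists L : probability (chain_path R) R,
  [/\ chain_law q j L,
      L [set w | forall i, 0 < holding i w] = 1%E,
      forall k t, P [set w | (first_visit X k w <= t%:E)%E] = L (hit_by k t) &
      forall r t, 0 <= t -> (\sum_(r <= n <oo) P [set w | X t w = Some n] = 1)%E ->
        L [set w | forall i, jump_time i w <= t] = 0%E].
Proof.
move=> [Y [H [law1 law2 H0 XE]]].
pose Z (w : Omega) : chain_path R := fun n => (Y n w, H n w).
have mY n : measurable_fun setT (Y n) by exact: measurable_funP.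
have mH n : measurable_fun setT (H n) by exact: measurable_funP.
have mZ : measurable_fun setT Z.
  apply: measurable_to_path => n a B mB.
  rewrite (_ : mkset _ = Y n @^-1` [set a] `&` H n @^-1` B)//.
  apply: measurableI; rewrite -[X in measurable X]setTI.
    exact: mY.
  exact: mH.
pose ZZ : {mfun Omega >-> chain_path R} := mfun_Sub (mem_set mZ).
have S0 i w : 0 <= jump_time i (Z w) by apply: sumr_ge0 => m _; exact/ltW/H0.
have S1 i w : jump_time i (Z w) < jump_time i.+1 (Z w).
  by rewrite /jump_time big_ord_recr/= ltrDl; exact: H0.
have Sle i i' w : (i <= i')%N -> jump_time i (Z w) <= jump_time i' (Z w).
  move=> ii'; have := @nondecreasing_seqP _ _ (fun i => jump_time i (Z w)).
  by case=> + _; apply => // m; exact: ltW.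
have visitE k t : [set w | (first_visit X k w <= t%:E)%E] = Z @^-1` hit_by k t.
  apply/seteqP; split=> w /=; last first.
    move=> [i [Yk St]]; apply: le_trans (_ : (jump_time i (Z w))%:E <= _)%E; last first.
      by rewrite lee_fin.
    apply: ereal_inf_lbound; exists (jump_time i (Z w)) => //=; split=> //.
    by apply/XE => //; exists i; split=> //; exact: S1.
  apply: contraPP => nhit; apply/negP; rewrite -ltNge.
  have [/= visit|novisit] := pselect (exists i, Y i w == k); last first.
    rewrite /first_visit (_ : [set _ | _ in _] = set0) ?ereal_inf0 ?ltry//.
    apply/seteqP; split=> // x [s [s0 Xs] sx].
    have [i [_ _ Yi]] := (XE s w k s0).1 Xs.
    by apply: novisit; exists i; apply/eqP.
  (* Jump times increase with the index, so the least index at which the jump chain is at k bounds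
     every visiting time from below. *)
  case: (ex_minnP visit) => i /eqP Yi mini.
  apply: (@lt_le_trans _ _ (jump_time i (Z w))%:E).
    rewrite lte_fin ltNge; apply/negP => Sit.
    by apply: nhit; exists i.
  apply: le_ereal_inf_tmp => _ [s [s0 Xs] <-]; rewrite lee_fin.
  have [i' [Si' _ Yi']] := (XE s w k s0).1 Xs.
  by apply: le_trans Si'; apply: Sle; apply: mini; rewrite Yi'.
exists (distribution P ZZ); split.
- move=> n i B mB; rewrite -law1 -law2//.
- rewrite -[RHS](probability_setT P); congr (P _).
  by apply/seteqP; split=> w //= _ i; exact: H0.
- by move=> k t; rewrite visitE.
- move=> r t t0 X1.
  pose F n : set Omega := [set w | X t w = Some n].
  (* [X] is not assumed measurable; this comes from its description by jump chain and holding
     times. *)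
  have mF n : measurable (F n).
    rewrite (_ : F n = \bigcup_i (Z @^-1` (([set w | jump_time i w <= t] `\`
        [set w | jump_time i.+1 w <= t]) `&` [set w | (w i).1 = n]))).
      apply: bigcupT_measurable => i; rewrite -[X in measurable X]setTI; apply: (mZ) => //.
      apply: measurableI; last exact: measurable_state.
      by apply: measurableD; exact: measurable_jump_time_le.
    apply/seteqP; split=> w /=.
      move=> /(XE t w n t0)[i [Si Si1 Yi]]; exists i => //; split => //; split => //.
      by apply/negP; rewrite -ltNge.
    move=> [i _ [[Si /negP]]]; rewrite -ltNge => Si1 Yi.
    by apply/(XE t w n t0); exists i.
  pose U := \bigcup_n F (n + r)%N.
  have mU : measurable U by exact: bigcupT_measurable.
  have PU : P U = 1%E.
    rewrite /U measure_semi_bigcup//.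
      by rewrite (nneseries_addn (f := fun i => P (F i))).
    apply/trivIsetP => i i' _ _ ii'; apply/seteqP; split=> w //= [].
    rewrite /F/= => -> [/eqP]; rewrite eqn_add2r => /eqP ii.
    by rewrite ii eqxx in ii'.
  rewrite -[LHS]/(P (Z @^-1` [set w | forall i, jump_time i w <= t])).
  apply/eqP; rewrite -measure_le0.
  have <- : P (~` U) = 0%E by rewrite probability_setC// PU subee.
  apply: le_measure; rewrite ?inE.
  - rewrite -[X in measurable X]setTI; apply: (mZ) => //.
    rewrite (_ : mkset _ = \bigcap_i [set w | jump_time i w <= t]).
      by apply: bigcapT_measurable => i; exact: measurable_jump_time_le.
    by apply/seteqP; split=> w //= wt i; [move=> _; exact: wt|exact: wt].
  - exact: measurableC.
  - move=> w /= wt [n _ /(XE t w _ t0)[i [_ + _]]].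
    by apply/negP; rewrite -leNgt; exact: (wt i.+1).
Qed.
End path_law.

Lemma ctmc_path_laws (R : realType) (d : measure_display) (Omega : measurableType d)
    (r : nat) (q : nat -> nat -> R) (P : nat -> probability Omega R)
    (X : R -> Omega -> option nat) :
  (forall j, (r <= j)%N -> ctmc_from (P j) q j X) ->
  exists L : nat -> probability (chain_path R) R,
  [/\ forall n, (r <= n)%N -> chain_law q n (L n),
      forall n, L n [set w | forall i, 0 < holding i w] = 1%E,
      forall n k, (r <= n)%N ->
        (fun t => fine (P n [set w | (first_visit X k w <= t%:E)%E])) = hit_cdf L k n &
      non_explosive P r X -> forall n t, (r <= n)%N -> 0 <= t ->
        L n [set w | forall i, jump_time i w <= t] = 0%E].
Proof.
move=> ctmc.
(* States below r get the law started at r, so that holding times are positive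
   under every L n. *)
have [L LP] := choice (fun n => ctmc_path_law (ctmc (maxn r n) (leq_maxl r n))).
exists L; split.
- by move=> n rn; have [+ _ _ _] := LP n; rewrite (maxn_idPr rn).
- by move=> n; have [] := LP n.
- move=> n k rn; have [_ _ + _] := LP n; rewrite (maxn_idPr rn) => H.
  by apply/funext => t; rewrite H.
- move=> Xne n t rn t0; have [_ _ _] := LP n; rewrite (maxn_idPr rn); apply => //.
  exact: Xne.
Qed.

(** * The rates of the two chains *)

Lemma exit_rateE (R : realType) (q : nat -> nat -> R) n : q n n = 0 ->
  (forall m, 0 <= q n m) -> (forall m, q n m != 0 -> (m <= n.+1)%N) ->
  exit_rate q n = \sum_(m < n.+2) q n m.
Proof.
move=> qnn q0 qs.
rewrite /exit_rate (nneseries_split_cond _ n.+2); last by move=> m _; rewrite lee_fin.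
rewrite [X in (_ + X)%E]eseries0 ?adde0; last first.
  move=> m nm _; have [->//|/qs] := eqVneq (q n m) 0.
  by rewrite leqNgt (leq_trans _ nm)// add0n.
rewrite add0n sumEFin/= big_mkord big_mkcond/=; apply: eq_bigr => m _.
by case: eqVneq => //= ->; rewrite qnn.
Qed.

Section rates.
Context {R : realType}.
Variables (r : nat) (alpha beta : nat -> R) (xi : R).
Local Notation bd := (bd_rate r alpha beta).
Local Notation bdc := (bdc_rate r alpha beta xi).

Lemma bd_rate_diag n : bd n n = 0.
Proof.
by rewrite /bd_rate ltn_eqF// !andbF.
Qed.

Lemma bd_rate_supp n m : bd n m != 0 -> (r <= m <= n.+1)%N.
Proof.
rewrite /bd_rate; case: ifP => [/andP[rn /eqP -> _]|_].
  by rewrite leqnn leqW.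
case: ifP => [/andP[rn /eqP nm _]|_]; last by rewrite eqxx.
by lia.
Qed.

(** At n = r + 1 death and catastrophe are the same transition, which is why its rate is the sum; so
    from every n above r the catastrophe just adds xi to the rate towards r. *)
Lemma bdc_rateE n m : (r <= n)%N ->
  bdc n m = bd n m + (if (r < n)%N && (m == r) then xi else 0).
Proof.
move=> rn; rewrite /bdc_rate /bd_rate rn/=.
have [->|mn] := eqVneq m n.+1.
  by rewrite gtn_eqF ?ltnS// andbF addr0.
have [nm|nm] := eqVneq n m.+1.
  have [r2n|r2n] := leqP r.+2 n.
    rewrite (ltnW r2n)/= gtn_eqF ?addr0//; lia.
  have [r1n|r1n] := leqP r.+1 n.
    have -> : n = r.+1 by lia.
    by rewrite eqxx (_ : m = r) ?eqxx//; lia.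
  by rewrite ltn_eqF//= addr0.
rewrite !andbF add0r.
have [nr|nr] := eqVneq n r.+1.
  have mr : (m == r) = false by lia.
  by rewrite mr /= !andbF.
by rewrite /= (_ : (r.+1 < n)%N = (r < n)%N)//; lia.
Qed.

Lemma bdc_rate_out n m : (n < r)%N -> bdc n m = 0.
Proof.
move=> nr; rewrite /bdc_rate leqNgt nr/=.
by rewrite !ifF//; lia.
Qed.

Lemma bdc_rate_diag n : bdc n n = 0.
Proof.
have [nr|rn] := ltnP n r; first by rewrite bdc_rate_out.
by rewrite bdc_rateE// bd_rate_diag ifF ?addr0//; lia.
Qed.

Lemma bdc_rate_supp n m : (r <= n)%N -> bdc n m != 0 -> (r <= m <= n.+1)%N.
Proof.
move=> rn; rewrite bdc_rateE//; case: ifP => [/andP[_ /eqP -> _]|_].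
  by rewrite leqnn (leq_trans rn).
by rewrite addr0; exact: bd_rate_supp.
Qed.

Lemma bdc_sum (g : nat -> R) n : (r <= n)%N ->
  \sum_(m < n.+2) bdc n m * g m =
  \sum_(m < n.+2) bd n m * g m + (if (r < n)%N then xi * g r else 0).
Proof.
move=> rn; under eq_bigr do rewrite bdc_rateE// mulrDl.
rewrite big_split/=; congr (_ + _).
have rn2 : (r < n.+2)%N by lia.
rewrite (bigD1 (Ordinal rn2))//= eqxx andbT big1 ?addr0.
  by case: ifP => // _; rewrite mul0r.
move=> m mr; rewrite ifF ?mul0r//; apply/negbTE; rewrite negb_and.
by apply/orP; right; apply: contra mr => /eqP mr; apply/eqP/val_inj.
Qed.

Hypotheses (halpha : forall n : nat, (r <= n)%N -> 0 < alpha n).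
Hypotheses (hbeta : forall n : nat, (r.+1 <= n)%N -> 0 <= beta n).
Hypotheses (hxi : 0 < xi).

Lemma bd_rate_ge0 n m : 0 <= bd n m.
Proof.
rewrite /bd_rate; case: ifP => [/andP[/halpha/ltW//]|_].
by case: ifP => // /andP[/hbeta].
Qed.

Lemma bdc_rate_ge0 n m : 0 <= bdc n m.
Proof.
have [nr|rn] := ltnP n r; first by rewrite bdc_rate_out.
rewrite bdc_rateE// addr_ge0 ?bd_rate_ge0//.
by case: ifP => // _; exact: ltW.
Qed.

Lemma bd_exitE n : exit_rate bd n = \sum_(m < n.+2) bd n m.
Proof.
apply: exit_rateE; first exact: bd_rate_diag.
- by move=> m; exact: bd_rate_ge0.
- by move=> m /bd_rate_supp/andP[].
Qed.

Lemma bdc_exitE n : (r <= n)%N -> exit_rate bdc n = \sum_(m < n.+2) bdc n m.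
Proof.
move=> rn; apply: exit_rateE; first exact: bdc_rate_diag.
- by move=> m; exact: bdc_rate_ge0.
- by move=> m /(bdc_rate_supp rn)/andP[].
Qed.

Lemma bd_exit_gt0 n : (r <= n)%N -> 0 < exit_rate bd n.
Proof.
move=> rn; rewrite bd_exitE (bigD1 (ord_max : 'I_n.+2))//=.
rewrite ltr_pwDl//; first by rewrite /bd_rate rn eqxx halpha.
by apply: sumr_ge0 => m _; exact: bd_rate_ge0.
Qed.

Lemma bdc_exit n : (r <= n)%N ->
  exit_rate bdc n = exit_rate bd n + (if (r < n)%N then xi else 0).
Proof.
move=> rn; rewrite bdc_exitE// bd_exitE.
transitivity (\sum_(m < n.+2) bdc n m * (fun=> 1) (m : nat)).
  by apply: eq_bigr => m _; rewrite mulr1.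
rewrite (bdc_sum (fun=> 1) rn) mulr1; congr (_ + _).
by apply: eq_bigr => m _; rewrite mulr1.
Qed.

Lemma bdc_exit_gt0 n : (r <= n)%N -> 0 < exit_rate bdc n.
Proof.
move=> rn; rewrite bdc_exit// ltr_pwDl ?bd_exit_gt0//.
by case: ifP => // _; exact: ltW.
Qed.

End rates.

(** * Comparison of the two chains *)

Unset Implicit Arguments.

Theorem theorem2p2 (R : realType) (r : nat) (alpha beta : nat -> R) (xi : R)
  (halpha : forall n : nat, (r <= n)%N -> 0 < alpha n)
  (hbeta : forall n : nat, (r.+1 <= n)%N -> 0 <= beta n)
  (hxi : 0 < xi)
  (* N under P j is the process with catastrophes given N(0) = j *)
  (d : measure_display) (Omega : measurableType d)
  (P : nat -> probability Omega R) (N : R -> Omega -> option nat)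
  (hN : forall j : nat, (r <= j)%N ->
     ctmc_from (P j) (bdc_rate r alpha beta xi) j N)
  (* Nh under Ph j is the process without catastrophes given Nh(0) = j *)
  (dh : measure_display) (Omegah : measurableType dh)
  (Ph : nat -> probability Omegah R) (Nh : R -> Omegah -> option nat)
  (hNh : forall j : nat, (r <= j)%N ->
     ctmc_from (Ph j) (bd_rate r alpha beta) j Nh)
  (hNh_ne : non_explosive Ph r Nh)
  (lambda : R) (hlambda : 0 < lambda)
  (j k : nat) (hj : (r <= j)%N) (hk : (r <= k)%N) (hjk : j <> k) :
  first_visit_laplace P N j k lambda =
  (lambda * first_visit_laplace Ph Nh j k (lambda + xi) +
   xi * first_visit_laplace Ph Nh r k (lambda + xi)) /
  (lambda + xi * first_visit_laplace Ph Nh r k (lambda + xi)).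
Proof.
have [L [lawL L_pos LE _]] := ctmc_path_laws hN.
have [Lh [lawLh Lh_pos LhE /(_ hNh_ne) Lh_ne]] := ctmc_path_laws hNh.
set bd := bd_rate r alpha beta; set bdc := bdc_rate r alpha beta xi.
have bd_ge0 := bd_rate_ge0 halpha hbeta.
have bd_diag n : bd n n = 0 by exact: bd_rate_diag.
have bd_supp n m : (r <= n)%N -> bd n m != 0 -> (r <= m <= n.+1)%N.
  by move=> _; exact: bd_rate_supp.
have bd_exit0 := bd_exit_gt0 halpha hbeta.
have bd_exitS n : (r <= n)%N -> exit_rate bd n = \sum_(m < n.+2) bd n m.
  by move=> _; exact: bd_exitE.
have bdc_ge0 := bdc_rate_ge0 halpha hbeta hxi.
have bdc_diag n : bdc n n = 0 by exact: bdc_rate_diag.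
have bdc_supp n m : (r <= n)%N -> bdc n m != 0 -> (r <= m <= n.+1)%N.
  exact: bdc_rate_supp.
have bdc_exit0 := bdc_exit_gt0 halpha hbeta hxi.
have bdc_exitS := bdc_exitE halpha hbeta hxi.
set mu := lambda + xi.
have mu0 : 0 < mu by exact: addr_gt0.
pose G n := transform lambda (hit_cdf L k n).
pose Gh n := transform mu (hit_cdf Lh k n).
have GhE n : (r <= n)%N -> first_visit_laplace Ph Nh n k mu = Gh n.
  move=> rn; rewrite /first_visit_laplace /first_visit_density LhE//.
  (* The case n = k matters when r = k: the conventional value 1 agrees with the transform of a
     visit at time 0. *)
  case: eqVneq => [->|nk]; first by rewrite /Gh (hit_transform_self bd_exit0 lawLh).
  exact: (hit_transform_derive bd_ge0 bd_diag bd_supp bd_exit0 bd_exitS lawLh Lh_pos).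
have GE : first_visit_laplace P N j k lambda = G j.
  rewrite /first_visit_laplace /first_visit_density LE//.
  case: eqVneq => // jk.
  exact: (hit_transform_derive bdc_ge0 bdc_diag bdc_supp bdc_exit0 bdc_exitS lawL L_pos).
have Gk : G k = 1 by exact: (hit_transform_self bdc_exit0 lawL).
have Ghk : Gh k = 1 by exact: (hit_transform_self bd_exit0 lawLh).
have Gstep n : (r <= n)%N -> n != k ->
    (mu + exit_rate bd n) * G n = \sum_(m < n.+2) bd n m * G m + xi * G r.
  move=> rn nk.
  have := hit_transform_step bdc_ge0 bdc_diag bdc_supp bdc_exit0 lawL L_pos rn nk hlambda.
  rewrite (bdc_sum alpha beta xi G rn) (bdc_exit halpha hbeta hxi rn) -/bd.
  rewrite -!/(G _) /mu.
  (* Above r, xi sits in the exit rate and the source is the catastrophe term; at r, xi times G r is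
     added on both sides. *)
  case: ifPn => [_ E|nr]; first by rewrite -[X in _ = X + _]addr0; lra.
  rewrite !addr0 => <-; have -> : n = r by lia.
  by ring.
(* The constant c is a particular solution: mu c = xi G r. The factor 1 - c in [D] is then forced by
   D k = 0. *)
pose c := xi / mu * G r.
pose D n := G n - c - (1 - c) * Gh n.
have D0 : forall n, (r <= n)%N -> D n = 0.
  apply: (bounded_solution_eq0 bd_ge0 bd_diag bd_supp bd_exit0 lawLh Lh_pos Lh_ne
    (k := k) (M := 1 + `|c| + `|1 - c|) mu0).
  - move=> n rn.
    have G01 : `|G n| <= 1.
      rewrite ger0_norm; last first.
        by apply: transform_ge0 => // t _; have /andP[] := hit_cdf01 L k n t.
      by apply: transform_le1 => // [|t _]; [exact: measurable_hit_cdf|exact: hit_cdf01].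
    have Gh01 : `|Gh n| <= 1.
      rewrite ger0_norm; last first.
        by apply: transform_ge0 => // t _; have /andP[] := hit_cdf01 Lh k n t.
      by apply: transform_le1 => // [|t _]; [exact: measurable_hit_cdf|exact: hit_cdf01].
    rewrite /D; apply: le_trans (ler_normB _ _) _; apply: lerD.
      by apply: le_trans (ler_normB _ _) _; exact: lerD.
    by rewrite normrM ler_piMr.
  - by rewrite /D Gk Ghk; ring.
  - move=> n rn nk.
    have Ghstep := hit_transform_step bd_ge0 bd_diag bd_supp bd_exit0 lawLh Lh_pos rn nk mu0.
    transitivity (\sum_(m < n.+2) bd n m * G m - c * \sum_(m < n.+2) bd n m
        - (1 - c) * \sum_(m < n.+2) bd n m * Gh m); last first.
      by rewrite !mulr_sumr -!sumrB; apply: eq_bigr => m _; rewrite /D -/bd; ring.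
    have -> : \sum_(m < n.+2) bd n m * G m = (mu + exit_rate bd n) * G n - mu * c.
      by rewrite Gstep// /c; field; rewrite gt_eqF.
    by rewrite -bd_exitS// -Ghstep /D -/(Gh n) -/bd; ring.
have Gh_r0 : 0 <= Gh r.
  by apply: transform_ge0 => // t _; have /andP[] := hit_cdf01 Lh k r t.
have den0 : 0 < lambda + xi * Gh r by rewrite ltr_pwDl// mulr_ge0// ltW.
have cE : c = xi * Gh r / (lambda + xi * Gh r).
  have Gr : G r = mu * Gh r / (lambda + xi * Gh r).
    apply: (mulIf (lt0r_neq0 den0)); rewrite mulfVK ?gt_eqF//.
    (* As c is a multiple of G r, the equation D r = 0 involves no other unknown than G r; mu - xi =
       lambda produces the denominator. *)
    have : mu * D r = 0 by rewrite D0// mulr0.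
    have -> : mu * D r = G r * (lambda + xi * Gh r) - mu * Gh r.
      by rewrite /D /c /mu; field; rewrite -/mu gt_eqF.
    by move/eqP; rewrite subr_eq0 => /eqP.
  by rewrite /c Gr; field; rewrite !gt_eqF.
rewrite GE !GhE//.
(* What remains is G j = c + (1 - c) Gh j, where 1 - c is lambda over the common denominator. *)
have /eqP := D0 j hj; rewrite /D -addrA -opprD subr_eq0 => /eqP ->.
by rewrite cE; field; rewrite gt_eqF.
Qed.
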